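(* Let $\eta\in\mathbb{C}\setminus\{0\}$ and let $\beta_0,\beta_1,\beta_2,\beta_3\in\mathbb{C}$ satisfy $\beta_0+\beta_1+2\beta_2+2\beta_3=1$. Consider an ordinary differential system $$\frac{dx}{dt}=f_1(x,y,z),\quad \frac{dy}{dt}=f_2(x,y,z),\quad \frac{dz}{dt}=f_3(x,y,z)$$ where $f_1,f_2,f_3$ are polynomials in $x,y,z$ with coefficients in $\mathbb{C}(t)$. Assume: (A1) $\deg(f_i)=6$ with respect to $x,y,z$ for $i=1,2,3$; (A2) the right-hand side of the system becomes again a polynomial in each of the coordinate systems $(x_i,y_i,z_i)$, $i=0,1,2,3$, where 0) $x_0=x-\eta,\ y_0=y,\ z_0=z-\frac{\beta_0}{x-\eta}$; 1) $x_1=x,\ y_1=y-1,\ z_1=z-\frac{\beta_1}{y-1}$; 2) $x_2=x+\frac{\beta_2}{z},\ y_2=y+\frac{\beta_2}{z},\ z_2=z$; 3) $x_3=x,\ y_3=y,\ z_3=z-\frac{\beta_3(x+y)}{xy}$. Then the system coincides with the $D_4^{(1)}$ system (defined in the context), for some $b(t)\in\mathbb{C}(t)$, with the parameter relations $\alpha_4=\alpha_1$, $\beta_0=\alpha_0$, $\beta_1=\alpha_3$, $\beta_2=\alpha_2$, $\beta_3=\alpha_1$.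
   Context: Condition (A2) means: for each $i$, when the system is rewritten in the coordinates $(x_i,y_i,z_i)$, the expressions for $dx_i/dt,dy_i/dt,dz_i/dt$ are polynomials in $x_i,y_i,z_i$ (with coefficients in $\mathbb{C}(t)$). The $D_4^{(1)}$ system. Let $\eta\in\mathbb{C}\setminus\{0\}$, let $b(t)\in\mathbb{C}(t)$ be nonzero, and let $\alpha_0,\dots,\alpha_4\in\mathbb{C}$ satisfy $\alpha_0+\alpha_1+2\alpha_2+\alpha_3+\alpha_4=1$. The $D_4^{(1)}$ system for unknown functions $x,y,z$ of $t$ is $$\frac{2\eta}{b(t)}\frac{dx}{dt}=P,\qquad -\frac{2\eta}{b(t)}\frac{dy}{dt}=Q,\qquad \frac{2\eta}{b(t)}\frac{dz}{dt}=R,$$ where $P=-2x(y-1)yz(x-\eta)(2x-2y+1-\eta)-2(2\alpha_0+2\alpha_1+4\alpha_2+\alpha_3+\alpha_4)x^3y-2(\alpha_0+\alpha_1)xy^3+(5\alpha_0+5\alpha_1+6\alpha_2+\alpha_3+\alpha_4)x^2y^2-\{5\alpha_0+5\alpha_1+6\alpha_2+2\alpha_3-3(2\alpha_0+2\alpha_1+4\alpha_2+\alpha_3+\alpha_4)\eta\}x^2y+\{3(\alpha_0+\alpha_1)-(4\alpha_0+6\alpha_1+6\alpha_2+\alpha_3+\alpha_4)\eta\}xy^2+x^4+2(\alpha_0+\alpha_1+2\alpha_2+\alpha_3-\eta)x^3+2\alpha_1\eta y^3+\{(\alpha_0+\alpha_1+2\alpha_2+\alpha_3)(\eta^2-3\eta+1)+\alpha_4\eta^2\}x^2+\alpha_1(\eta-3)\eta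 y^2+\{-(\alpha_0+\alpha_1)+2(2\alpha_0+3\alpha_1+3\alpha_2+\alpha_3)\eta-(2\alpha_0+2\alpha_1+4\alpha_2+\alpha_3+\alpha_4)\eta^2\}xy+(\alpha_0+\alpha_1+2\alpha_2+\alpha_3)(\eta-1)\eta x-\alpha_1(\eta-1)\eta y$, $Q=2x(y-1)yz(x-\eta)(2x-2y+1-\eta)-2(\alpha_3+\alpha_4)x^3y-2(\alpha_0+\alpha_1+4\alpha_2+2\alpha_3+2\alpha_4)xy^3+(\alpha_0+\alpha_1+6\alpha_2+5\alpha_3+5\alpha_4)x^2y^2+\{-(\alpha_0+\alpha_1+6\alpha_2+4\alpha_3+6\alpha_4)+3(\alpha_3+\alpha_4)\eta\}x^2y+\{3(\alpha_0+\alpha_1+4\alpha_2+2\alpha_3+2\alpha_4)-(2\alpha_0+6\alpha_2+5\alpha_3+5\alpha_4)\eta\}xy^2+y^4+2\alpha_4x^3+2\{(\alpha_0+2\alpha_2+\alpha_3+\alpha_4)\eta-1\}y^3-\alpha_4(3\eta-1)x^2+\{1-3(\alpha_0+2\alpha_2+\alpha_3+\alpha_4)\eta+(\alpha_0+2\alpha_2+\alpha_3+\alpha_4)\eta^2\}y^2+\{-(\alpha_0+\alpha_1+4\alpha_2+2\alpha_3+2\alpha_4)+2(\alpha_0+3\alpha_2+2\alpha_3+3\alpha_4)\eta-(\alpha_3+\alpha_4)\eta^2\}xy+\alpha_4(\eta-1)\eta x-(\alpha_0+2\alpha_2+\alpha_3+\alpha_4)(\eta-1)\eta y$, $R=(2x-2y+1-\eta)\{2x^2y+2xy^2-x^2-\eta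 y^2-2(\eta+1)xy+\eta(x+y)\}z^2+z\big[-2(\alpha_3+\alpha_4)x^3+2(\alpha_0+\alpha_1)y^3+2(\alpha_0+\alpha_1+6\alpha_2+2\alpha_3+2\alpha_4)x^2y-2(2\alpha_0+2\alpha_1+6\alpha_2+\alpha_3+\alpha_4)xy^2+\{-(\alpha_0+\alpha_1+6\alpha_2+4\alpha_3)+3(\alpha_3+\alpha_4)\eta\}x^2+\{-3(\alpha_0+\alpha_1)+(4\alpha_0+6\alpha_2+\alpha_3+\alpha_4)\eta\}y^2-4\{-(\alpha_0+\alpha_1+3\alpha_2+\alpha_3)+(\alpha_0+3\alpha_2+\alpha_3+\alpha_4)\eta\}xy+\{-(\alpha_0+\alpha_1+4\alpha_2+2\alpha_3)+2(\alpha_0+3\alpha_2+2\alpha_3)\eta-(\alpha_3+\alpha_4)\eta^2\}x+\{\alpha_0+\alpha_1-2(2\alpha_0+3\alpha_2+\alpha_3)\eta+(2\alpha_0+4\alpha_2+\alpha_3+\alpha_4)\eta^2\}y-(\alpha_0+2\alpha_2+\alpha_3)(\eta-1)\eta\big]+\alpha_2\big[(\alpha_0+\alpha_1+2\alpha_2-\alpha_3-\alpha_4)x^2+(\alpha_0+\alpha_1-2\alpha_2-\alpha_3-\alpha_4)y^2-2(\alpha_0+\alpha_1-\alpha_3-\alpha_4)xy+\{\alpha_0+\alpha_1-2\alpha_3-(2\alpha_0+2\alpha_2-\alpha_3-\alpha_4)\eta\}x+\{-\alpha_0-\alpha_1+2\alpha_2+2\alpha_3+(2\alpha_0-\alpha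_3-\alpha_4)\eta\}y+(\eta-1)(\alpha_2+\alpha_3+(\alpha_0+\alpha_2)\eta)\big]$.
   Formalization: The formal theorem also assumes η≠1, η≠−1 and β0, β1, β2, β3 all nonzero; without these the claim fails, e.g. β=(1,0,0,0), f1=f2=(x−η)²y⁴, f3=y⁶ satisfies (A1) and (A2) but is not a D4 system. *)

(* Defs.v *)
From HB Require Import structures.
From mathcomp Require Import all_boot all_order all_algebra.
From mathcomp Require Import reals complex.
From mathcomp Require Import mpoly.

Set Implicit Arguments.
Unset Strict Implicit.
Unset Printing Implicit Defensive.

Import GRing.Theory.
Local Open Scope ring_scope.

(* For R : realType, the complex numbers are R[i]; C(t), C(t)[x,y,z] and
   C(t)(x,y,z) are the three types below, with x, y, z = 'X_0, 'X_1, 'X_2. *)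
Notation ratfun_t R := {fraction {poly R[i]}}.
Notation poly_xyz R := {mpoly (ratfun_t R)[3]}.
Notation ratfun_xyz R := {fraction (poly_xyz R)}.

Notation "x %:F" := (@FracField.tofrac _ x) : ring_scope.

(* Quotient rule: if d is a derivation of A, then [frac_der d] is its unique
   extension to the field of fractions of A (so the value does not depend on
   the representative n/m chosen by [repr]). *)
Definition frac_der (A : idomainType) (d : A -> A) (u : {fraction A}) :
    {fraction A} :=
  let n := \n_(repr u) in
  let m := \d_(repr u) in
  (d n * m - n * d m)%:F / (m ^+ 2)%:F.

Section System.
Variable R : realType.

Definition ddt : ratfun_t R -> ratfun_t R := frac_der (@deriv R[i]).

(* The system dx/dt = f_0, dy/dt = f_1, dz/dt = f_2 is given by the tuple f.
   [along f p] is dp/dt along its solutions: d/dt acts on the coefficients of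
   p, plus the chain rule in x, y, z. *)
Definition along (f : 3.-tuple (poly_xyz R)) (p : poly_xyz R) : poly_xyz R :=
  map_mpoly ddt p + \sum_(j < 3) p^`M(j) * tnth f j.

Definition total_der (f : 3.-tuple (poly_xyz R)) :
    ratfun_xyz R -> ratfun_xyz R :=
  frac_der (along f).

Definition cst_t (c : R[i]) : ratfun_t R := (c%:P)%:F.
Definition cst_xyz (c : R[i]) : poly_xyz R := (cst_t c)%:MP.

(* g(w_0, w_1, w_2) in C(t)(x,y,z), for g in C(t)[x,y,z]. *)
Definition subst_xyz (w : 3.-tuple (ratfun_xyz R)) (g : poly_xyz R) :
    ratfun_xyz R :=
  mmap (fun a : ratfun_t R => (a%:MP : poly_xyz R)%:F) (tnth w) g.

Definition polynomial_in (f : 3.-tuple (poly_xyz R))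
    (w : 3.-tuple (ratfun_xyz R)) : Prop :=
  exists g : 3.-tuple (poly_xyz R),
    forall j : 'I_3, total_der f (tnth w j) = subst_xyz w (tnth g j).

Definition vx : poly_xyz R := 'X_(inord 0).
Definition vy : poly_xyz R := 'X_(inord 1).
Definition vz : poly_xyz R := 'X_(inord 2).

Definition coords0 (eta b0 : R[i]) : 3.-tuple (ratfun_xyz R) :=
  let x := vx%:F in let y := vy%:F in let z := vz%:F in
  let c a := (cst_xyz a)%:F in
  [tuple x - c eta; y; z - c b0 / (x - c eta)].

Definition coords1 (b1 : R[i]) : 3.-tuple (ratfun_xyz R) :=
  let x := vx%:F in let y := vy%:F in let z := vz%:F in
  let c a := (cst_xyz a)%:F in
  [tuple x; y - 1; z - c b1 / (y - 1)].

Definition coords2 (b2 : R[i]) : 3.-tuple (ratfun_xyz R) :=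
  let x := vx%:F in let y := vy%:F in let z := vz%:F in
  let c a := (cst_xyz a)%:F in
  [tuple x + c b2 / z; y + c b2 / z; z].

Definition coords3 (b3 : R[i]) : 3.-tuple (ratfun_xyz R) :=
  let x := vx%:F in let y := vy%:F in let z := vz%:F in
  let c a := (cst_xyz a)%:F in
  [tuple x; y; z - c b3 * (x + y) / (x * y)].

End System.

Section D4.
Variable A : comNzRingType.
Variables (x y z eta a0 a1 a2 a3 a4 : A).

Definition D4P : A :=
  - 2 * x * (y - 1) * y * z * (x - eta) * (2 * x - 2 * y + 1 - eta)
  - 2 * (2 * a0 + 2 * a1 + 4 * a2 + a3 + a4) * x ^+ 3 * y
  - 2 * (a0 + a1) * x * y ^+ 3
  + (5 * a0 + 5 * a1 + 6 * a2 + a3 + a4) * x ^+ 2 * y ^+ 2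
  - (5 * a0 + 5 * a1 + 6 * a2 + 2 * a3
     - 3 * (2 * a0 + 2 * a1 + 4 * a2 + a3 + a4) * eta) * x ^+ 2 * y
  + (3 * (a0 + a1) - (4 * a0 + 6 * a1 + 6 * a2 + a3 + a4) * eta) * x * y ^+ 2
  + x ^+ 4
  + 2 * (a0 + a1 + 2 * a2 + a3 - eta) * x ^+ 3
  + 2 * a1 * eta * y ^+ 3
  + ((a0 + a1 + 2 * a2 + a3) * (eta ^+ 2 - 3 * eta + 1) + a4 * eta ^+ 2)
    * x ^+ 2
  + a1 * (eta - 3) * eta * y ^+ 2
  + (- (a0 + a1) + 2 * (2 * a0 + 3 * a1 + 3 * a2 + a3) * eta
     - (2 * a0 + 2 * a1 + 4 * a2 + a3 + a4) * eta ^+ 2) * x * y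
  + (a0 + a1 + 2 * a2 + a3) * (eta - 1) * eta * x
  - a1 * (eta - 1) * eta * y.

Definition D4Q : A :=
  2 * x * (y - 1) * y * z * (x - eta) * (2 * x - 2 * y + 1 - eta)
  - 2 * (a3 + a4) * x ^+ 3 * y
  - 2 * (a0 + a1 + 4 * a2 + 2 * a3 + 2 * a4) * x * y ^+ 3
  + (a0 + a1 + 6 * a2 + 5 * a3 + 5 * a4) * x ^+ 2 * y ^+ 2
  + (- (a0 + a1 + 6 * a2 + 4 * a3 + 6 * a4) + 3 * (a3 + a4) * eta)
    * x ^+ 2 * y
  + (3 * (a0 + a1 + 4 * a2 + 2 * a3 + 2 * a4)
     - (2 * a0 + 6 * a2 + 5 * a3 + 5 * a4) * eta) * x * y ^+ 2
  + y ^+ 4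
  + 2 * a4 * x ^+ 3
  + 2 * ((a0 + 2 * a2 + a3 + a4) * eta - 1) * y ^+ 3
  - a4 * (3 * eta - 1) * x ^+ 2
  + (1 - 3 * (a0 + 2 * a2 + a3 + a4) * eta
     + (a0 + 2 * a2 + a3 + a4) * eta ^+ 2) * y ^+ 2
  + (- (a0 + a1 + 4 * a2 + 2 * a3 + 2 * a4)
     + 2 * (a0 + 3 * a2 + 2 * a3 + 3 * a4) * eta
     - (a3 + a4) * eta ^+ 2) * x * y
  + a4 * (eta - 1) * eta * x
  - (a0 + 2 * a2 + a3 + a4) * (eta - 1) * eta * y.

Definition D4R : A :=
  (2 * x - 2 * y + 1 - eta)
  * (2 * x ^+ 2 * y + 2 * x * y ^+ 2 - x ^+ 2 - eta * y ^+ 2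
     - 2 * (eta + 1) * x * y + eta * (x + y)) * z ^+ 2
  + z * (- 2 * (a3 + a4) * x ^+ 3
         + 2 * (a0 + a1) * y ^+ 3
         + 2 * (a0 + a1 + 6 * a2 + 2 * a3 + 2 * a4) * x ^+ 2 * y
         - 2 * (2 * a0 + 2 * a1 + 6 * a2 + a3 + a4) * x * y ^+ 2
         + (- (a0 + a1 + 6 * a2 + 4 * a3) + 3 * (a3 + a4) * eta) * x ^+ 2
         + (- 3 * (a0 + a1) + (4 * a0 + 6 * a2 + a3 + a4) * eta) * y ^+ 2
         - 4 * (- (a0 + a1 + 3 * a2 + a3) + (a0 + 3 * a2 + a3 + a4) * eta)
           * x * y
         + (- (a0 + a1 + 4 * a2 + 2 * a3) + 2 * (a0 + 3 * a2 + 2 * a3) * eta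
            - (a3 + a4) * eta ^+ 2) * x
         + (a0 + a1 - 2 * (2 * a0 + 3 * a2 + a3) * eta
            + (2 * a0 + 4 * a2 + a3 + a4) * eta ^+ 2) * y
         - (a0 + 2 * a2 + a3) * (eta - 1) * eta)
  + a2 * ((a0 + a1 + 2 * a2 - a3 - a4) * x ^+ 2
          + (a0 + a1 - 2 * a2 - a3 - a4) * y ^+ 2
          - 2 * (a0 + a1 - a3 - a4) * x * y
          + (a0 + a1 - 2 * a3 - (2 * a0 + 2 * a2 - a3 - a4) * eta) * x
          + (- a0 - a1 + 2 * a2 + 2 * a3 + (2 * a0 - a3 - a4) * eta) * y
          + (eta - 1) * (a2 + a3 + (a0 + a2) * eta)).

End D4.

Definition D4_system (R : realType) (eta : R[i]) (b : ratfun_t R)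
    (a0 a1 a2 a3 a4 : R[i]) (f : 3.-tuple (poly_xyz R)) : Prop :=
  let c := @cst_xyz R in
  let k : ratfun_t R := 2 * cst_t eta / b in
  [/\ k *: tnth f (inord 0) =
        D4P (vx R) (vy R) (vz R) (c eta) (c a0) (c a1) (c a2) (c a3) (c a4),
      - k *: tnth f (inord 1) =
        D4Q (vx R) (vy R) (vz R) (c eta) (c a0) (c a1) (c a2) (c a3) (c a4)
    & k *: tnth f (inord 2) =
        D4R (vx R) (vy R) (vz R) (c eta) (c a0) (c a1) (c a2) (c a3) (c a4)].

(* Main.v *)
Require Import Defs.
From HB Require Import structures.
From mathcomp Require Import all_boot all_order all_algebra.
From mathcomp Require Import reals complex.
From mathcomp Require Import mpoly.
From mathcomp Require Import polyXY ring zify.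

Set Implicit Arguments.
Unset Strict Implicit.
Unset Printing Implicit Defensive.

Import GRing.Theory.
Local Open Scope ring_scope.

(** Put d = x - y.  Over the field K(d), with K = C(t), the ring
K[x,y,z] becomes a part of K(d)[x,z], and each denominator of the charts
singles out one place of the line with coordinate x: the functions x,
x - eta, y, y - 1 vanish at x = 0, eta, d, d + 1, and the chart with
x + b2/z, y + b2/z (where d does not change) lives at x = infinity.  So the
hypotheses are five local conditions on the right-hand sides
F = f1, E = f2, H = f3, seen as polynomials in z over K(d)[x].

Near a place p with local coordinate u = x - p and residue b, the chart
coordinate is z - b/u, so z = (s + b)/u with s/u regular.  Grade by giving z
weight 1 and u weight -1.  Substitution turns the part of weight N of a
polynomial into u^-N times a polynomial in s, hence regularity says that this
part, as a polynomial in the product uz, is divisible by (uz - b)^N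
([regular_pole_free]).  The derivative of z - b/u is (u^2 H + b F)/u^2 or
(u^2 H + b E)/u^2, which gives conditions of the same kind on H.

Total degree 6 leaves so few monomials that a part of weight N is usually
smaller than (uz - b)^N, hence zero.  Each coefficient in z then has the four
roots 0, eta, d, d + 1, and the condition at infinity bounds its degree in x.
What remains ([classification]) is, with G = x(x-eta)(x-d)(x-d-1),
  F = A + L G z,   E = F - u,   H determined by A and L,
where L and u do not depend on x and z, and A is a polynomial in x of degree at
most 3 with leading coefficient b2 L and values at the four roots of G given by
b0, b1, b3, L and u.  These are five conditions on the four coefficients of A;
since b0 + b1 + 2 b2 + 2 b3 = 1, the Lagrange interpolation formula turns their
compatibility into ([lagrange_relation])
  L d (d - eta)(d + 1)(d + 1 - eta) = - 2 (2d + 1 - eta) u.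
By the bound on the degree of F, L is a polynomial of degree at most 1 in d.
For eta different from 1 and -1 the factor 2d + 1 - eta is prime to the quartic
on the left, hence divides L ([slope_divides]): L = c (2d + 1 - eta) with c in K.
So the solutions form one line over K ([system_unique]), and c is not 0 because
f1 is not 0.  The D4 system lies on this line: written in x, d, z, its right-hand
sides have the form above ([D4PE], [D4QE], [D4RE]).  Comparing the factors
gives b = - eta c. *)

(** * Derivations of a field of fractions *)

(** Giving the field of fractions a name keeps unification from unfolding the
algebraic structures of the iterated fields of fractions below. *)
Definition frac_field (A : idomainType) : fieldType := {fraction A}.

Section Derivations.

Definition derivation (A : pzRingType) (d : A -> A) : Prop :=
  (forall a b, d (a + b) = d a + d b) /\ (forall a b, d (a * b) = d a * b + a * d b).

Section Ring.
Variables (A : pzRingType) (d : A -> A).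
Hypothesis dP : derivation d.

Lemma derivationD a b : d (a + b) = d a + d b. Proof. exact: dP.1. Qed.
Lemma derivationM a b : d (a * b) = d a * b + a * d b. Proof. exact: dP.2. Qed.

Lemma derivation0 : d 0 = 0.
Proof. by apply: (addrI (d 0)); rewrite -derivationD !addr0. Qed.

Lemma derivation1 : d 1 = 0.
Proof.
have := derivationM 1 1; rewrite !mulr1 mul1r => E.
by apply: (addrI (d 1)); rewrite -E addr0.
Qed.

Lemma derivationN a : d (- a) = - d a.
Proof. by apply/eqP; rewrite -addr_eq0 -derivationD addNr derivation0. Qed.

Lemma derivationB a b : d (a - b) = d a - d b.
Proof. by rewrite derivationD derivationN. Qed.
End Ring.

Section Combination.
Variable A : comPzRingType.

Lemma derivation_add (d e : A -> A) :
  derivation d -> derivation e -> derivation (fun a => d a + e a).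
Proof.
move=> dP eP; split=> a b /=.
  by rewrite (derivationD dP) (derivationD eP) addrACA.
by rewrite (derivationM dP) (derivationM eP); ring.
Qed.

Lemma derivation_scale (d : A -> A) c :
  derivation d -> derivation (fun a => d a * c).
Proof.
move=> dP; split=> a b /=; first by rewrite (derivationD dP) mulrDl.
by rewrite (derivationM dP); ring.
Qed.

Lemma derivation_sum n (d : 'I_n -> A -> A) :
  (forall j, derivation (d j)) -> derivation (fun a => \sum_(j < n) d j a).
Proof.
move=> dP; split=> a b; rewrite -?big_split /=.
  by apply: eq_bigr => j _; rewrite (derivationD (dP j)).
rewrite mulr_suml mulr_sumr -big_split /=.
by apply: eq_bigr => j _; rewrite (derivationM (dP j)).
Qed.
End Combination.

Lemma derivation_div (K : fieldType) (d : K -> K) a b : derivation d -> b != 0 ->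
  d (a / b) = (d a * b - a * d b) / b ^+ 2.
Proof.
move=> dP b0; have := derivationM dP (a / b) b; rewrite divfK // => ->.
by field.
Qed.

Section Fraction.
Variables (A : idomainType) (d : A -> A).
Hypothesis dP : derivation d.

Lemma frac_numden (u : {fraction A}) :
  u = (\n_(repr u))%:F / (\d_(repr u))%:F.
Proof.
have d0 : (\d_(repr u))%:F != 0 :> {fraction A}.
  rewrite tofrac_eq0; exact: denom_ratioP.
apply: (mulIf d0); rewrite divfK // -{1}[u]reprK.
apply/eqP; rewrite !piE.
have d1 : \d_(repr u) != 0 by exact: denom_ratioP.
have o1 : 1 != 0 :> A by apply: oner_neq0.
rewrite /FracField.mulf /FracField.equivf !numden_Ratio ?mulf_neq0 //.
by rewrite !mulr1 mulrC.
Qed.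

(** Independence of the representative: differentiating n m' = n' m gives the
relation between the two quotient rules. *)
Lemma frac_der_div n m : m != 0 ->
  frac_der d (n%:F / m%:F) = (d n * m - n * d m)%:F / (m ^+ 2)%:F.
Proof.
move=> m0; rewrite /frac_der; set u := n%:F / m%:F.
set n' := \n_(repr u); set m' := \d_(repr u).
have m'0 : m' != 0 by exact: denom_ratioP.
have nm : n * m' = n' * m.
  apply/eqP; rewrite -tofrac_eq !rmorphM /=.
  have := frac_numden u; rewrite -/n' -/m' /u => /eqP.
  by rewrite eqr_div ?tofrac_eq0 // => /eqP->.
have dnm : d n * m' + n * d m' = d n' * m + n' * d m.
  by rewrite -!derivationM // nm.
apply/eqP; rewrite eqr_div ?tofrac_eq0 ?expf_neq0 // -!rmorphM tofrac_eq /=; apply/eqP.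
apply: (mulfI m'0); apply: (mulfI m0).
have e1 : d n' * m = d n * m' + n * d m' - n' * d m by rewrite dnm; ring.
rewrite [LHS](_ : _ = m' * m ^+ 2 * ((d n' * m) * m' - (n' * m) * d m')); last by ring.
rewrite e1 -nm.
rewrite [LHS](_ : _ = m' * m * (d n * m * m' ^+ 2 - n' * m * m' * d m)); last by ring.
by rewrite -nm; ring.
Qed.

Lemma frac_der_tofrac n : frac_der d n%:F = (d n)%:F.
Proof.
have := frac_der_div n (oner_neq0 A).
by rewrite rmorph1 divr1 mulr1 (derivation1 dP) mulr0 subr0 expr1n rmorph1 divr1.
Qed.

Lemma frac_derD n m n' m' : m != 0 -> m' != 0 ->
  frac_der d (n%:F / m%:F + n'%:F / m'%:F) =
  frac_der d (n%:F / m%:F) + frac_der d (n'%:F / m'%:F).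
Proof.
move=> m0 m'0; rewrite addf_div ?tofrac_eq0 // -!rmorphM -rmorphD /=.
rewrite !frac_der_div ?mulf_neq0 // addf_div ?tofrac_eq0 ?expf_neq0 //.
apply/eqP; rewrite eqr_div ?mulf_neq0 ?tofrac_eq0 ?expf_neq0 ?mulf_neq0 //.
rewrite -!(rmorphM, rmorphD) tofrac_eq /= (derivationD dP) !(derivationM dP).
by apply/eqP; ring.
Qed.

Lemma frac_derM n m n' m' : m != 0 -> m' != 0 ->
  frac_der d (n%:F / m%:F * (n'%:F / m'%:F)) =
  frac_der d (n%:F / m%:F) * (n'%:F / m'%:F) +
  n%:F / m%:F * frac_der d (n'%:F / m'%:F).
Proof.
move=> m0 m'0; rewrite mulf_div -!rmorphM /=.
rewrite !frac_der_div ?mulf_neq0 // !mulf_div addf_div; last first.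
- by rewrite mulf_neq0 ?tofrac_eq0 ?expf_neq0.
- by rewrite mulf_neq0 ?tofrac_eq0 ?expf_neq0.
apply/eqP; rewrite eqr_div ?mulf_neq0 ?tofrac_eq0 ?expf_neq0 ?mulf_neq0 //.
rewrite -!(rmorphM, rmorphD) tofrac_eq /= !(derivationM dP).
by apply/eqP; ring.
Qed.

Lemma frac_der_derivation : derivation (frac_der d : frac_field A -> frac_field A).
Proof.
split=> u v; rewrite (frac_numden u) (frac_numden v).
  by apply: frac_derD; apply: denom_ratioP.
by apply: frac_derM; apply: denom_ratioP.
Qed.

End Fraction.
End Derivations.

(** * The derivative along a system *)
Section TotalDerivative.
Variable R : realType.
Implicit Type f : 3.-tuple (poly_xyz R).

Lemma ddt_derivation :
  derivation (@ddt R : frac_field {poly R[i]} -> frac_field {poly R[i]}).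
Proof.
by apply: frac_der_derivation; split=> p q; [exact: derivD | exact: derivM].
Qed.

Lemma ddt_zmod_morphism : zmod_morphism (@ddt R).
Proof. by move=> a b; rewrite (derivationB ddt_derivation). Qed.
HB.instance Definition _ :=
  GRing.isZmodMorphism.Build (ratfun_t R) (ratfun_t R) (@ddt R) ddt_zmod_morphism.

Lemma ddt_cst (c : R[i]) : ddt (cst_t c) = 0.
Proof.
rewrite /ddt frac_der_tofrac ?derivC ?rmorph0 //.
by split=> p q; [exact: derivD | exact: derivM].
Qed.

Lemma map_ddt_monomial (c : ratfun_t R) m :
  map_mpoly (@ddt R) (c *: 'X_[m]) = ddt c *: 'X_[m] :> poly_xyz R.
Proof.
apply/mpolyP => m'; rewrite mcoeff_map_mpoly !mcoeffZ mcoeffX.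
by case: (m == m'); [rewrite !mulr1 | rewrite !mulr0 raddf0].
Qed.

Lemma map_ddt_derivation : derivation (map_mpoly (@ddt R) : poly_xyz R -> _).
Proof.
split=> [p q|]; first exact: raddfD.
elim/mpolyind=> [|c m p _ _ IHp] q; first by rewrite !(mul0r, raddf0) add0r.
rewrite mulrDl !raddfD /= IHp !mulrDl addrACA; congr (_ + _) => {p IHp}.
elim/mpolyind: q => [|c' m' q _ _ IHq]; first by rewrite !(mulr0, raddf0) add0r.
rewrite mulrDr !raddfD /= IHq !mulrDr addrACA; congr (_ + _) => {q IHq}.
rewrite -scalerAl -scalerAr scalerA -mpolyXD !map_ddt_monomial.
rewrite (derivationM ddt_derivation) scalerDl.
by rewrite -!scalerAl -!scalerAr !scalerA -!mpolyXD.
Qed.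

Lemma along_derivation f : derivation (along f).
Proof.
apply: derivation_add map_ddt_derivation _; apply: derivation_sum => j.
by apply: derivation_scale; split=> p q; [apply: mderivD | apply: mderivM].
Qed.

Lemma total_der_derivation f :
  derivation (total_der f : frac_field (poly_xyz R) -> frac_field (poly_xyz R)).
Proof. exact: frac_der_derivation (along_derivation f). Qed.

Lemma alongX f i : along f 'X_i = tnth f i.
Proof.
rewrite /along -[X in map_mpoly _ X]scale1r map_ddt_monomial (derivation1 ddt_derivation).
rewrite scale0r add0r (bigD1 i) //= big1 ?addr0 => [|j ne_ji].
  by rewrite mderivX mnm1E eqxx scale1r -[X in (X - _)%MM]add0m addmK mpolyX0 mul1r.
by rewrite mderivX mnm1E eq_sym (negPf ne_ji) scale0r mul0r.
Qed.

Lemma along_cst f (c : R[i]) : along f (cst_xyz c) = 0.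
Proof.
rewrite /along /cst_xyz big1 => [|j _]; last by rewrite mderivC mul0r.
by rewrite addr0 map_mpolyC /= ddt_cst mpolyC0.
Qed.

Lemma total_derE f p : total_der f p%:F = (along f p)%:F.
Proof. exact: frac_der_tofrac (along_derivation f) _. Qed.

End TotalDerivative.

(** * Divisibility of weight parts at a simple pole *)
Section WeightPart.
Variable k : fieldType.
Implicit Types (b p : k) (h F H : {poly {poly k}}) (W : {poly k}).

(** In h, let w be the outer and v the inner variable, of weights 1 and -1.  The
monomials of weight N are w^(N+i) v^i = w^N (v w)^i; hence the part of weight N
is recorded as a polynomial in the invariant product v w. *)
Definition weight_part N h : {poly k} := \poly_(i < sizeY h) h`_(N + i)`_i.

Lemma coef_weight_part N h i : (weight_part N h)`_i = h`_(N + i)`_i.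
Proof.
rewrite coef_poly; case: ltnP => // le_i.
by rewrite nth_default // (leq_trans (max_size_coefXY h _)).
Qed.

(** The algebraic form of the statement that h(v, w)/v^e has no pole along
v = 0 when w - b/v is regular there.  For b nonzero, w^e has the same pole as
v^-e, and multiplying by it keeps h a polynomial. *)
Definition pole_free b e h :=
  forall N, ('X - b%:P) ^+ N %| weight_part N (h * 'X^e).

Lemma small_multiple_eq0 b N W :
  ('X - b%:P) ^+ N %| W -> (size W <= N)%N -> W = 0.
Proof.
move=> dvW leW; apply/eqP; apply: contraLR leW => nzW.
by rewrite -ltnNge; have := dvdp_leq nzW dvW; rewrite size_exp_XsubC.
Qed.

Lemma small_multiple b N W :
  ('X - b%:P) ^+ N %| W -> (size W <= N.+1)%N -> W = W`_N *: ('X - b%:P) ^+ N.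
Proof.
move=> dvW leW; apply/eqP; rewrite -subr_eq0; apply/eqP.
apply: (@small_multiple_eq0 b N).
  by rewrite dvdp_sub // -mul_polyC dvdp_mull.
apply/leq_sizeP => j le_Nj; rewrite coefB coefZ.
have mon : ('X - b%:P) ^+ N \is monic by rewrite monic_exp // monicXsubC.
have sz : size (('X - b%:P) ^+ N) = N.+1 by rewrite size_exp_XsubC.
move: le_Nj; rewrite leq_eqVlt => /orP[/eqP <-|lt_Nj].
  have := monicP mon; rewrite lead_coefE sz /= => ->.
  by rewrite mulr1 subrr.
rewrite (nth_default _ (leq_trans leW lt_Nj)) [_`_j]nth_default ?sz //.
by rewrite mulr0 subrr.
Qed.

Definition shift p F : {poly {poly k}} := map_poly (comp_poly ('X + p%:P)) F.

Lemma coef_shift p F l : (shift p F)`_l = F`_l \Po ('X + p%:P).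
Proof. by rewrite coef_map. Qed.

Lemma coef0_translate p (A : {poly k}) : (A \Po ('X + p%:P))`_0 = A.[p].
Proof. by rewrite -horner_coef0 horner_comp !hornerE. Qed.

Lemma deriv_translate p (A : {poly k}) :
  (A \Po ('X + p%:P))^`() = A^`() \Po ('X + p%:P).
Proof. by rewrite deriv_comp derivD derivX derivC addr0 mulr1. Qed.

Lemma coef1_translate p (A : {poly k}) : (A \Po ('X + p%:P))`_1 = A^`().[p].
Proof. by rewrite -coef0_translate -deriv_translate coef_deriv. Qed.

Lemma coef2_translate p (A : {poly k}) :
  (A \Po ('X + p%:P))`_2 *+ 2 = A^`()^`().[p].
Proof. by rewrite -coef1_translate -deriv_translate coef_deriv. Qed.

(** A pole at the point p of the base with residue b.  F is the derivative of the
local coordinate v = X - p and H that of w, so that the derivative of w - b/v is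
(v^2 H + b F)/v^2.  In the lemmas, [F`_l] and [H`_l] are the coefficients of w^l,
and each lemma reads one weight part. *)
Section Pole.
Variables (p b : k) (F H : {poly {poly k}}).
Hypothesis F_free : pole_free b 0 (shift p F).

(** For K the degree in w, the part of weight K is a constant, smaller than
(X - b)^K. *)
Lemma lead_coef_root : (1 < size F)%N -> (lead_coef F).[p] = 0.
Proof.
move=> szF.
pose K := (size F).-1.
have K_gt0 : (0 < K)%N by rewrite /K -ltnS prednK // ltnW.
have szFK : size F = K.+1 by rewrite prednK // ltnW.
have := F_free K; rewrite expr0 mulr1 => /small_multiple_eq0 W0.
rewrite lead_coefE -/K -coef0_translate -coef_shift.
have <- : (weight_part K (shift p F))`_0 = (shift p F)`_K`_0.
  by rewrite coef_weight_part addn0.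
rewrite W0 ?coef0 //; apply/leq_sizeP => j le_Kj.
rewrite coef_weight_part coef_shift [F`_(K + j)]nth_default ?comp_poly0 ?coef0 //.
by rewrite szFK; lia.
Qed.

(** Multiplication by w^2 accounts for the denominator v^2: the coefficient of
w^l v^i moves to w^(l+2) v^i, so H contributes from v^2 on. *)
Lemma coef_pole l i :
  (('X^2 *: shift p H + b%:P *: shift p F) * 'X^2)`_l.+2`_i =
  (if (i < 2)%N then 0 else (H`_l \Po ('X + p%:P))`_(i - 2))
  + b * (F`_l \Po ('X + p%:P))`_i.
Proof.
rewrite coefMXn /= subn2 /= coefD !coefZ !coef_shift coefD.
by rewrite [_ * (H`_l \Po _)]mulrC coefMXn coefCM.
Qed.

Hypothesis H_free :
  pole_free b 2 ('X^2 *: shift p H + b%:P *: shift p F).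
Hypothesis szF : (size F <= 3)%N.

(** The part of weight equal to the degree of H in w has size at most 3, too
small for a degree at least 3; F is too short to interfere. *)
Lemma lead_coef_root2 : (3 < size H)%N -> (lead_coef H).[p] = 0.
Proof.
move=> szH.
have [K szHK] : exists K, size H = K.+3.+1.
  by exists (size H - 4)%N; lia.
have := H_free K.+3 => /small_multiple_eq0 W0.
have FK l : (3 <= l)%N -> F`_l = 0.
  by move=> le_l; rewrite nth_default // (leq_trans szF).
have HK l : (K.+3 < l)%N -> H`_l = 0.
  by move=> le_l; rewrite nth_default // szHK.
have := congr1 (fun W : {poly k} => W`_2) (W0 _).
rewrite coef_weight_part coef0 addn2 coef_pole /= coef0_translate.
rewrite FK // comp_poly0 coef0 mulr0 addr0 lead_coefE szHK; apply.
apply/leq_sizeP => j le_j; rewrite coef_weight_part.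
have -> : (K.+3 + j = (K.+3 + j - 2).+2)%N by lia.
rewrite coef_pole FK ?comp_poly0 ?coef0 ?mulr0 ?addr0; last by lia.
case: ltnP => // _; rewrite HK ?comp_poly0 ?coef0 //; lia.
Qed.

Hypothesis b_neq0 : b != 0.
Hypothesis szH : (size H <= 3)%N.

Let F0 l : (3 <= l)%N -> F`_l = 0.
Proof. by move=> le_l; rewrite nth_default // (leq_trans szF). Qed.
Let H0 l : (3 <= l)%N -> H`_l = 0.
Proof. by move=> le_l; rewrite nth_default // (leq_trans szH). Qed.

(** Weight 3: the part has size at most 3, so it vanishes; its linear coefficient
is b F_2'(p). *)
Lemma quadratic_part_deriv0 : (F`_2)^`().[p] = 0.
Proof.
have := H_free 3 => /small_multiple_eq0 W0.
have := congr1 (fun W : {poly k} => W`_1) (W0 _).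
rewrite coef_weight_part coef0 /= coef_pole /= add0r coef1_translate => W1.
apply: (mulfI b_neq0); rewrite mulr0; apply: W1.
apply/leq_sizeP => j le_j; rewrite coef_weight_part.
have -> : (3 + j = (3 + j - 2).+2)%N by lia.
rewrite coef_pole F0 ?H0 ?comp_poly0 ?coef0 ?mulr0 ?addr0 ?if_same //; lia.
Qed.

Hypothesis F2 : F`_2 = 0.

Let F0' l : (2 <= l)%N -> F`_l = 0.
Proof. by rewrite leq_eqVlt => /orP[/eqP<-//|]; apply: F0. Qed.

Lemma linear_part_root : (F`_1).[p] = 0.
Proof.
have := F_free 1; rewrite expr0 mulr1 => /small_multiple_eq0 W0.
have := congr1 (fun W : {poly k} => W`_0) (W0 _).
rewrite coef_weight_part coef0 /= coef_shift coef0_translate; apply.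
apply/leq_sizeP => j le_j; rewrite coef_weight_part coef_shift.
by rewrite F0' ?comp_poly0 ?coef0.
Qed.

(** Weight 2: the part has size at most 3 and top coefficient H_2(p), so it is
H_2(p) (X - b)^2; its other coefficients are b F_0(p) and b F_1'(p). *)
Lemma residue_relations :
  (F`_1)^`().[p] = - ((H`_2).[p] *+ 2) /\ (F`_0).[p] = b * (H`_2).[p].
Proof.
have := H_free 2 => /small_multiple W0.
have {}W0 := W0 _.
have szW : (size (weight_part 2
  (('X^2 *: shift p H + b%:P *: shift p F) * 'X^2)) <= 3)%N.
  apply/leq_sizeP => j le_j; rewrite coef_weight_part.
  have -> : (2 + j = j.+2)%N by lia.
  by rewrite coef_pole F0 ?H0 ?comp_poly0 ?coef0 ?mulr0 ?addr0 ?if_same.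
have {}W0 := W0 szW.
have W_0 := congr1 (fun W : {poly k} => W`_0) W0.
have W_1 := congr1 (fun W : {poly k} => W`_1) W0.
move: W_0 W_1.
rewrite !(coef_weight_part, coefZ) !coef_pole /= !add0r.
rewrite F2 comp_poly0 coef0 mulr0 addr0 !(coef0_translate, coef1_translate).
have -> : (('X - b%:P) ^+ 2)`_0 = b ^+ 2.
  by rewrite -horner_coef0 !hornerE; ring.
have -> : (('X - b%:P) ^+ 2)`_1 = - (b *+ 2).
  have -> : ('X - b%:P) ^+ 2 = 'X^2 - (b *+ 2)%:P * 'X + (b ^+ 2)%:P :> {poly k}.
    by rewrite rmorphMn rmorphXn /=; ring.
  by rewrite coefD coefB coefXn coefCM coefX coefC /=; ring.
move=> W_0 W_1; split; apply: (mulfI b_neq0).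
  by rewrite W_1; ring.
by rewrite W_0; ring.
Qed.

(** Weight 1: the condition is the vanishing of the part at X = b. *)
Lemma subresidue_relation :
  (F`_0)^`().[p] + (H`_1).[p] + b * ((F`_1 \Po ('X + p%:P))`_2 + (H`_2)^`().[p]) = 0.
Proof.
have := H_free 1; rewrite expr1 dvdp_XsubCl => /rootP.
rewrite (@horner_coef_wide _ 4); last first.
  apply/leq_sizeP => j le_j; rewrite coef_weight_part.
  have -> : (1 + j = (j - 1).+2)%N by lia.
  by rewrite coef_pole F0 ?H0 ?comp_poly0 ?coef0 ?mulr0 ?addr0 ?if_same //; lia.
rewrite !big_ord_recl big_ord0 /= !coef_weight_part /bump /= !coef_pole /=.
rewrite /bump /= coefMXn /= coef0.
rewrite F2 comp_poly0 coef0 mulr0 !addr0 !add0r !(coef0_translate, coef1_translate).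
set x := (_ \Po _)`_2 => E.
apply: (mulfI (expf_neq0 2 b_neq0)); rewrite mulr0 -[RHS]E; ring.
Qed.

End Pole.
End WeightPart.

(** * The pole at infinity *)

(** Now z plays the role of the local coordinate and x that of the coordinate with
a pole, whence the exchange of variables.  F and H are the derivatives of x and
z; D is the derivative of x - y, in which the pole b/z cancels. *)
Section PoleAtInfinity.
Variables (k : fieldType) (b : k) (F D H : {poly {poly k}}).
Hypothesis b_neq0 : b != 0.
Hypothesis H_free : pole_free b 0 (swapXY H).
Hypothesis D_free : pole_free b 0 (swapXY D).
Hypothesis F_free : pole_free b 2 ('X^2 *: swapXY F + b%:P *: swapXY H).
Hypotheses (szF : (size F <= 2)%N) (szD : (size D <= 2)%N).
Hypotheses (szH : (size H <= 3)%N).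

Let F0 l : (2 <= l)%N -> F`_l = 0.
Proof. by move=> le_l; rewrite nth_default // (leq_trans szF). Qed.
Let D0 l : (2 <= l)%N -> D`_l = 0.
Proof. by move=> le_l; rewrite nth_default // (leq_trans szD). Qed.
Let H0 l : (3 <= l)%N -> H`_l = 0.
Proof. by move=> le_l; rewrite nth_default // (leq_trans szH). Qed.

Let WD N := weight_part N (swapXY D).
Let WH N := weight_part N (swapXY H).
Let WF n := weight_part n.+2 (('X^2 *: swapXY F + b%:P *: swapXY H) * 'X^2).

Let coefWD N i : (WD N)`_i = D`_i`_(N + i).
Proof. by rewrite coef_weight_part coef_swapXY. Qed.
Let coefWH N i : (WH N)`_i = H`_i`_(N + i).
Proof. by rewrite coef_weight_part coef_swapXY. Qed.
Let coefWF n i : (WF n)`_i =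
  (if (i < 2)%N then 0 else F`_(i - 2)`_(n + i)) + b * H`_i`_(n + i).
Proof.
rewrite coef_weight_part !addSn coefMXn /= subn2 /= coefD !coefZ.
by rewrite coefD [_ * (swapXY F)`__]mulrC coefMXn coefCM !coef_swapXY.
Qed.

Let szWD N : (size (WD N) <= 2)%N.
Proof. by apply/leq_sizeP => j lj; rewrite coefWD D0 // coef0. Qed.
Let szWH N : (size (WH N) <= 3)%N.
Proof. by apply/leq_sizeP => j lj; rewrite coefWH H0 // coef0. Qed.
Let szWF N : (size (WF N) <= 4)%N.
Proof.
apply/leq_sizeP => j lj; rewrite coefWF F0 ?(leq_sub2r 2 lj) //.
by rewrite H0 ?(ltnW lj) // !coef0 mulr0 addr0 if_same.
Qed.

Let WD_mult N : ('X - b%:P) ^+ N %| WD N.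
Proof. by have := D_free N; rewrite expr0 mulr1. Qed.
Let WH_mult N : ('X - b%:P) ^+ N %| WH N.
Proof. by have := H_free N; rewrite expr0 mulr1. Qed.
Let WF_mult n : ('X - b%:P) ^+ n.+2 %| WF n.
Proof. exact: F_free. Qed.

(** D is linear in z, so its parts of weight at least 2 vanish, and that of weight 1
is a multiple of X - b. *)
Lemma difference_degree :
  [/\ (size (D`_0)%R <= 2)%N, (size (D`_1)%R <= 3)%N & (D`_0)`_1 = - (b * (D`_1)`_2)].
Proof.
have W0 N : (2 <= N)%N -> WD N = 0.
  by move=> le_N; rewrite (small_multiple_eq0 (WD_mult N)) // (leq_trans (szWD N)).
split.
- apply/leq_sizeP => j le_j; have := coefWD j 0; rewrite addn0 => <-.
  by rewrite W0 ?coef0.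
- apply/leq_sizeP => -[//|j] le_j; have := coefWD j 1; rewrite addn1 => <-.
  by rewrite W0 ?coef0.
have := small_multiple (WD_mult 1) (szWD 1) => /(congr1 (fun W => nth 0 (polyseq W) 0)).
rewrite coefZ !coefWD expr1 coefB coefX coefC /= => ->; ring.
Qed.

Let WF0 n : (2 <= n)%N -> WF n = 0.
Proof.
by move=> le_n; rewrite (small_multiple_eq0 (WF_mult n)) // (leq_trans (szWF n)).
Qed.

Let WH0 n : (3 <= n)%N -> WH n = 0.
Proof.
by move=> le_n; rewrite (small_multiple_eq0 (WH_mult n)) // (leq_trans (szWH n)).
Qed.

(** The part of weight n + 2 of x^2 (z^2 F + b H) has size at most 4, so it vanishes
for n at least 2; the coefficient of z^2 in H is bounded by the regularity of H
itself. *)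
Lemma infinity_degree :
  [/\ (size (F`_0)%R <= 4)%N, (size (F`_1)%R <= 5)%N &
   [/\ (size (H`_0)%R <= 2)%N, (size (H`_1)%R <= 3)%N & (size (H`_2)%R <= 4)%N]].
Proof.
have sH0 : (size (H`_0)%R <= 2)%N.
  apply/leq_sizeP => j le_j; have := coefWF j 0; rewrite addn0 WF0 // coef0.
  by rewrite add0r => /esym/eqP; rewrite mulf_eq0 (negPf b_neq0) => /eqP.
have sH1 : (size (H`_1)%R <= 3)%N.
  apply/leq_sizeP => -[//|j] le_j; have := coefWF j 1; rewrite addn1 WF0 // coef0.
  by rewrite add0r => /esym/eqP; rewrite mulf_eq0 (negPf b_neq0) => /eqP.
have H24 : (H`_2)`_4 = 0.
  have /(congr1 (fun W => nth 0 (polyseq W) 0)) := small_multiple (WH_mult 2) (szWH 2).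
  rewrite coefZ !coefWH addn0 (nth_default _ sH0) addn2.
  have -> : (('X - b%:P) ^+ 2)`_0 = b ^+ 2 by rewrite -horner_coef0 !hornerE; ring.
  by move/esym/eqP; rewrite mulf_eq0 expf_eq0 /= (negPf b_neq0) orbF => /eqP.
have sH2 : (size (H`_2)%R <= 4)%N.
  apply/leq_sizeP => j; rewrite leq_eqVlt => /orP[/eqP<-//|].
  by case: j => [//|[//|j]] le_j; have := coefWH j 2; rewrite addn2 => <-; rewrite WH0 ?coef0.
split=> //.
  apply/leq_sizeP => -[//|[//|j]] le_j; have := coefWF j 2.
  rewrite addn2 WF0 // coef0 subnn (nth_default _ (leq_trans sH2 le_j)) mulr0 addr0.
  by move <-.
apply/leq_sizeP => -[//|[//|[//|j]]] le_j; have := coefWF j 3.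
by rewrite addn3 WF0 // coef0 H0 // coef0 mulr0 addr0 => <-.
Qed.

(** The part of weight 3 of x^2 (z^2 F + b H) has size at most 4 and top coefficient
L, so it is L (X - b)^3; from the part of weight 2, the vanishing at b suffices. *)
Lemma infinity_relations : let L := (F`_1)`_4 in
  [/\ (H`_0)`_1 = - (b ^+ 2 * L), (F`_0)`_3 + b * (H`_2)`_3 = - (b * L *+ 3) &
      (H`_0)`_0 = - (b * (H`_1`_1 + (F`_0)`_2 + b * (H`_2`_2 + (F`_1)`_3)))].
Proof.
move=> L; have H3 : H`_3 = 0 by rewrite H0.
have E := small_multiple (WF_mult 1) (szWF 1).
have cube : ('X - b%:P) ^+ 3 = 'X^3 - (b *+ 3)%:P * 'X^2 + (b ^+ 2 *+ 3)%:P * 'X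
    - (b ^+ 3)%:P :> {poly k} by rewrite !rmorphMn !rmorphXn /=; ring.
have E0 : b * (H`_0)`_1 = - (b ^+ 3 * L).
  have := congr1 (fun W => nth 0 (polyseq W) 0) E; rewrite coefZ !coefWF /= add0r => ->.
  rewrite H3 coef0 mulr0 addr0 -/L cube.
  by rewrite !(coefB, coefD, coefXn, coefCM, coefC, coefX) /=; ring.
have E2 : (F`_0)`_3 + b * (H`_2)`_3 = - (b * L *+ 3).
  have := congr1 (fun W => nth 0 (polyseq W) 2) E; rewrite coefZ !coefWF /= => ->.
  rewrite H3 coef0 mulr0 addr0 -/L cube.
  by rewrite !(coefB, coefD, coefXn, coefCM, coefC, coefX) /=; ring.
split=> //; first by apply: (mulfI b_neq0); rewrite E0; ring.
have := dvdp_trans (dvdp_exp2l _ (isT : (1 <= 2)%N)) (WF_mult 0).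
rewrite expr1 dvdp_XsubCl => /rootP; rewrite (horner_coef_wide _ (szWF 0)).
rewrite !big_ord_recl big_ord0 /= /bump /= !coefWF /= H3 coef0 => E'.
apply: (mulfI b_neq0); apply/eqP; rewrite -subr_eq0 -[X in _ == X]E'; apply/eqP.
rewrite !add0n; ring.
Qed.

End PoleAtInfinity.

(** * Evaluation of polynomials in two variables *)
Section Evaluation.
Variables (k : fieldType) (S : comNzRingType) (iota : {rmorphism k -> S}).

Definition ev1 (a : S) : {poly k} -> S := horner_eval a \o map_poly iota.
HB.instance Definition _ a := GRing.RMorphism.copy (ev1 a) (horner_eval a \o map_poly iota).

Definition ev2 (a w : S) : {poly {poly k}} -> S := horner_eval w \o map_poly (ev1 a).
HB.instance Definition _ a w :=
  GRing.RMorphism.copy (ev2 a w) (horner_eval w \o map_poly (ev1 a)).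

Lemma ev1C a c : ev1 a c%:P = iota c.
Proof. by rewrite /ev1 /= /horner_eval map_polyC hornerC. Qed.

Lemma ev1X a : ev1 a 'X = a.
Proof. by rewrite /ev1 /= /horner_eval map_polyX hornerX. Qed.

Lemma ev2C a w p : ev2 a w p%:P = ev1 a p.
Proof. by rewrite /ev2 /= /horner_eval map_polyC hornerC. Qed.

Lemma ev2X a w : ev2 a w 'X = w.
Proof. by rewrite /ev2 /= /horner_eval map_polyX hornerX. Qed.

Lemma ev2Z a w p P : ev2 a w (p *: P) = ev1 a p * ev2 a w P.
Proof. by rewrite -mul_polyC rmorphM /= ev2C. Qed.

Lemma ev2D a w P Q : ev2 a w (P + Q) = ev2 a w P + ev2 a w Q.
Proof. exact: rmorphD. Qed.

Lemma ev2B a w P Q : ev2 a w (P - Q) = ev2 a w P - ev2 a w Q.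
Proof. exact: rmorphB. Qed.

Lemma ev1Xn a n : ev1 a 'X^n = a ^+ n.
Proof. by rewrite rmorphXn /= ev1X. Qed.

Lemma ev2_swapXY a w P : ev2 a w (swapXY P) = ev2 w a P.
Proof.
elim/poly_ind: P => [|P p IH]; first by rewrite !rmorph0.
rewrite !rmorphD !rmorphM /= IH swapXY_X swapXY_polyC !ev2X !ev2C ev1X.
congr (_ + _); rewrite /ev2 /= /horner_eval -map_poly_comp.
by congr horner; apply: eq_map_poly => c /=; rewrite ev1C.
Qed.

Lemma ev1_translate a p (A : {poly k}) :
  ev1 a (A \Po ('X + p%:P)) = ev1 (iota p + a) A.
Proof.
elim/poly_ind: A => [|A c IH]; first by rewrite comp_poly0 !rmorph0.
rewrite comp_polyD comp_polyM comp_polyX comp_polyC !rmorphD !rmorphM /= IH.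
by rewrite rmorphD /= !ev1X !ev1C [a + _]addrC.
Qed.

Lemma ev2_shift a w p P : ev2 a w (shift p P) = ev2 (iota p + a) w P.
Proof.
elim/poly_ind: P => [|P A IH]; first by rewrite /shift !rmorph0.
rewrite /shift !rmorphD !rmorphM /= -/(shift p P) IH map_polyX map_polyC /=.
by rewrite !ev2X !ev2C ev1_translate.
Qed.

End Evaluation.

(** * Blowing up a simple pole *)
Section BlowUp.
Variable k : fieldType.
Implicit Types (b : k) (a : {poly k}) (m : {poly k}) (h P : {poly {poly k}}).

(** The field k(s, t): t is the local coordinate of the chart and s/t its second
coordinate. *)
Notation E := (frac_field {poly {poly k}}).
Definition blow_const : k -> E := (@FracField.tofrac _) \o polyC \o polyC.
HB.instance Definition _ :=
  GRing.RMorphism.copy blow_const ((@FracField.tofrac _) \o polyC \o polyC).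
Notation iota := blow_const.
Definition blow_t : E := 'X%:F.
Definition blow_s : E := ('X%:P)%:F.
Notation t := blow_t.
Notation s := blow_s.
Notation ev1 := (ev1 iota).
Notation ev2 := (ev2 iota).

Lemma blow_t_neq0 : t != 0.
Proof. by rewrite tofrac_eq0 polyX_eq0. Qed.

Lemma ev1_blow_t m : ev1 t m = (map_poly polyC m)%:F.
Proof.
elim/poly_ind: m => [|m c IH]; first by rewrite !rmorph0.
by rewrite !rmorphD !rmorphM /= IH ev1C ev1X map_polyX map_polyC.
Qed.

Lemma ev1_blow_t_neq0 m : m.[0] != 0 -> ev1 t m != 0.
Proof.
rewrite ev1_blow_t tofrac_eq0; apply: contraNneq => m0.
have /(congr1 (map_poly (horner_eval 0))) := m0.
rewrite map_poly0 -map_poly_comp map_poly_id => [->|c _ /=]; first by rewrite horner0.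
by rewrite /horner_eval hornerC.
Qed.

(** Polynomials in t and s/t over a polynomial in t that does not vanish at 0: a ring
large enough to contain the inverse of y near x = 0 and that of x near y = 0. *)
Definition regular (q : E) : Prop :=
  exists m P, m.[0] != 0 /\ ev1 t m * q = ev2 t (s / t) P.

Lemma regular_ev2 P : regular (ev2 t (s / t) P).
Proof. by exists 1, P; rewrite hornerC oner_neq0 rmorph1 mul1r. Qed.

Lemma regularD q r : regular q -> regular r -> regular (q + r).
Proof.
move=> [m [P [m0 mP]]] [n [Q [n0 nQ]]].
exists (m * n), (n *: P + m *: Q); split; first by rewrite hornerM mulf_neq0.
by rewrite rmorphD /= !ev2Z -mP -nQ rmorphM /=; ring.
Qed.

Lemma regularM q r : regular q -> regular r -> regular (q * r).
Proof.
move=> [m [P [m0 mP]]] [n [Q [n0 nQ]]].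
exists (m * n), (P * Q); split; first by rewrite hornerM mulf_neq0.
by rewrite !rmorphM /= -mP -nQ; ring.
Qed.

Lemma regular_const c : regular (iota c).
Proof. by have := regular_ev2 c%:P%:P; rewrite ev2C ev1C. Qed.

Lemma regularN q : regular q -> regular (- q).
Proof.
move=> hq; rewrite -mulN1r; apply: regularM => //.
by rewrite -(rmorphN1 iota); apply: regular_const.
Qed.

Lemma regularB q r : regular q -> regular r -> regular (q - r).
Proof. by move=> hq hr; apply: regularD => //; apply: regularN. Qed.

Lemma regularX q n : regular q -> regular (q ^+ n).
Proof.
move=> hq; elim: n => [|n IH]; last by rewrite exprS; apply: regularM.
by rewrite expr0 -(rmorph1 iota); apply: regular_const.
Qed.

Lemma regular_t : regular t.
Proof. by have := regular_ev2 'X%:P; rewrite ev2C ev1X. Qed.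

Lemma regular_s_t : regular (s / t).
Proof. by have := regular_ev2 'X; rewrite ev2X. Qed.

Lemma regular_s : regular s.
Proof.
have -> : s = s / t * t by rewrite mulfVK ?blow_t_neq0.
by apply: regularM; [apply: regular_s_t | apply: regular_t].
Qed.

Lemma regularV m : m.[0] != 0 -> regular (ev1 t m)^-1.
Proof.
move=> m0; exists m, 1; split=> //.
by rewrite mulfV ?ev1_blow_t_neq0 // rmorph1.
Qed.

(** This is t^M h(t, a/t), a polynomial in t over k[s] as soon as M bounds the degree
in the second variable. *)
Definition homogenized (M : nat) (a : {poly k}) h : {poly {poly k}} :=
  \sum_(l < size h) map_poly polyC h`_l * 'X^(M - l) * (a ^+ l)%:P.

Lemma clear_denominator (K : fieldType) (u v e w : K) :
  v != 0 -> u * v * (e * (w / v)) = e * u * w.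
Proof. by move=> v0; field. Qed.

Lemma homogenizedE M a h : (size h <= M)%N ->
  t ^+ M * ev2 t (a%:P%:F / t) h = (homogenized M a h)%:F.
Proof.
move=> le_hM; rewrite /homogenized rmorph_sum /=.
rewrite {1}/ev2 /= /horner_eval horner_poly mulr_sumr; apply: eq_bigr => l _.
rewrite -{1}(subnK (leq_trans (ltnW (ltn_ord l)) le_hM)) exprD.
rewrite !rmorphM /= !rmorphXn /= -ev1_blow_t expr_div_n.
have tl : t ^+ l != 0 by rewrite expf_neq0 ?blow_t_neq0.
exact: clear_denominator.
Qed.

Lemma coef_homogenized M a h N : (N <= M)%N -> (size h <= M)%N ->
  (homogenized M a h)`_(M - N) =
  \sum_(l < size h) (if (l < N)%N then 0 else (h`_l)`_(l - N) *: a ^+ l).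
Proof.
move=> le_NM le_hM; rewrite coef_sum; apply: eq_bigr => l _.
have lt_lM := leq_trans (ltn_ord l) le_hM.
rewrite coefMC coefMXn coef_map -mul_polyC.
have -> : (M - N < M - l)%N = (l < N)%N by apply/idP/idP; lia.
case: ltnP => le_Nl; first by rewrite mul0r.
by congr (((_ : {poly k})`_ _)%:P * _); lia.
Qed.

Lemma sum_ord_widen (V : nmodType) (f : nat -> V) (m n : nat) :
  (m <= n)%N -> (forall l, (m <= l)%N -> f l = 0) ->
  \sum_(l < m) f l = \sum_(l < n) f l.
Proof.
move=> le_mn f0; rewrite (big_ord_widen _ _ le_mn) big_mkcond.
by apply: eq_bigr => l _; case: ltnP => // /f0.
Qed.

(** A monomial of weight N becomes t^-N times a power of a, so the powers of t
separate the weights. *)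
Lemma homogenized_weight_part M a h N : (N <= M)%N -> (size h <= M)%N ->
  (homogenized M a h)`_(M - N) = a ^+ N * (weight_part N h \Po a).
Proof.
move=> le_NM le_hM; rewrite coef_homogenized //.
pose n := (size h + sizeY h)%N.
pose f l := if (l < N)%N then 0 else (h`_l)`_(l - N) *: a ^+ l.
rewrite (@sum_ord_widen _ f _ (N + n)); last first.
- move=> l le_l; rewrite /f; case: ltnP => // _.
  by rewrite [h`_l]nth_default // coef0 scale0r.
- by rewrite /n; lia.
rewrite big_split_ord /= big1 ?add0r => [|l _]; last by rewrite /f ltn_ord.
rewrite comp_polyE mulr_sumr.
rewrite (@sum_ord_widen _ (fun i => a ^+ N * ((weight_part N h)`_i *: a ^+ i)) _ n).
- apply: eq_bigr => i _; rewrite /f ltnNge leq_addr /= coef_weight_part addKn.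
  by rewrite -scalerAr exprD.
- by rewrite (leq_trans (size_poly _ _)) // /n leq_addl.
by move=> i le_i; rewrite nth_default // scale0r mulr0.
Qed.

(** A polynomial in t with nonzero constant term is a unit among power series in t,
so multiplication by it preserves the filtration given by the powers of s that
divide the coefficients; the proof is an induction on the power of t. *)
Lemma dvd_unit_mul m (Q : {poly {poly k}}) M : m.[0] != 0 ->
  (forall J, (J <= M)%N -> 'X^(M - J) %| (map_poly polyC m * Q)`_J) ->
  forall J, (J <= M)%N -> 'X^(M - J) %| Q`_J.
Proof.
move=> m0 dvQ; elim/ltn_ind=> J IH le_JM; have := dvQ J le_JM.
rewrite coefM big_ord_recl /= subn0 coef_map /= dvdp_addl; last first.
  apply: (big_ind (fun q => 'X^(M - J) %| q)) => [|q r|i _]; first exact: dvdp0.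
    exact: dvdp_add.
  apply: dvdp_mull; have lt_i : (J - bump 0 i < J)%N.
    by have := ltn_ord i; rewrite /bump; lia.
  apply: dvdp_trans (IH _ lt_i _); last by lia.
  by apply: dvdp_exp2l; lia.
by rewrite -horner_coef0 mul_polyC dvdpZr.
Qed.

(** Multiply by t^M and by the denominator m: on the side of a polynomial P in
t and s/t, the coefficient of t^(M-N) is divisible by s^N.  On the side of h it
is (s + b)^N times the part of weight N at s + b, and s + b is prime to s. *)
Lemma regular_weight_part b h N : b != 0 ->
  regular (ev2 t ((s + iota b) / t) h) -> ('X - b%:P) ^+ N %| weight_part N h.
Proof.
move=> b0 [m [P [m0 mP]]].
pose M := (N + size h + size P)%N.
have key : map_poly polyC m * homogenized M ('X + b%:P) h = homogenized M 'X P.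
  apply/eqP; rewrite -tofrac_eq rmorphM /= -ev1_blow_t -!homogenizedE; try by rewrite /M; lia.
  by rewrite mulrCA !rmorphD /= mP.
have dvN : 'X^N %| (homogenized M ('X + b%:P) h)`_(M - N).
  have le_NM : (N <= M)%N by rewrite /M; lia.
  rewrite -[X in 'X^X](subKn le_NM); apply: dvd_unit_mul m0 _ _ (leq_subr _ _) => J le_JM.
  rewrite key -[X in _ `_ X](subKn le_JM) homogenized_weight_part ?leq_subr //.
    exact: dvdp_mulr.
  by rewrite /M; lia.
move: dvN; rewrite homogenized_weight_part; try by rewrite /M; lia.
rewrite Gauss_dvdpr; last first.
  rewrite coprimep_expl // coprimep_expr //.
  by rewrite -[b]opprK rmorphN coprimep_XsubC rootE hornerX oppr_eq0.
case/dvdpP => q Wq; apply/dvdpP; exists (q \Po ('X - b%:P)).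
have := congr1 (fun W => W \Po ('X - b%:P)) Wq.
rewrite -comp_polyA comp_polyD comp_polyX comp_polyC subrK comp_polyXr => ->.
by rewrite comp_polyM comp_Xn_poly.
Qed.

Lemma regular_pole_free b e h : b != 0 ->
  regular (ev2 t ((s + iota b) / t) h / t ^+ e) -> pole_free b e h.
Proof.
move=> b0 reg N; apply: regular_weight_part => //.
rewrite rmorphM rmorphXn /= ev2X expr_div_n mulrCA; apply: regularM => //.
by apply: regularX; apply: regularD; [apply: regular_s | apply: regular_const].
Qed.

End BlowUp.

(** * Vector fields with four finite poles and one at infinity *)

(** F, E, H are the derivatives of x, y, z, as polynomials in z over k[x], where
x - y is constant.  At p1 and p2 the pole of z lies along the zeros of x - cst, at
p3 and p4 along those of y - cst; this is why F and E are exchanged at the last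
two places. *)
Section Classification.
Variables (k : fieldType) (p1 p2 p3 p4 b1 b2 b3 b4 c : k).
Variables (F E H : {poly {poly k}}).

Definition holo_at p b (F E H : {poly {poly k}}) : Prop :=
  [/\ b != 0, pole_free b 0 (shift p F), pole_free b 0 (shift p E)
    & pole_free b 2 ('X^2 *: shift p H + b%:P *: shift p F)].

Definition quartic : {poly k} := \prod_(p <- [:: p1; p2; p3; p4]) ('X - p%:P).

Hypothesis two_neq0 : 2 != 0 :> k.
Hypothesis c_neq0 : c != 0.
Hypothesis p_uniq : uniq [:: p1; p2; p3; p4].

Lemma size_quartic : size quartic = 5.
Proof. by rewrite size_prod_XsubC. Qed.

Lemma quartic_lead : quartic`_4 = 1.
Proof.
have /monicP : quartic \is monic by rewrite monic_prod_XsubC.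
by rewrite lead_coefE size_quartic.
Qed.

Lemma root_quartic p : p \in [:: p1; p2; p3; p4] -> quartic.[p] = 0.
Proof. by move=> hp; apply/rootP; rewrite root_prod_XsubC. Qed.

Lemma four_roots_eq0 (A : {poly k}) : (size A <= 4)%N ->
  {in [:: p1; p2; p3; p4], forall p, A.[p] = 0} -> A = 0.
Proof.
move=> szA rootA; apply: (@roots_geq_poly_eq0 _ _ [:: p1; p2; p3; p4]) => //.
by apply/allP => p hp; apply/rootP/rootA.
Qed.

Lemma four_roots_scale (A : {poly k}) : (size A <= 5)%N ->
  {in [:: p1; p2; p3; p4], forall p, A.[p] = 0} -> A = A`_4 *: quartic.
Proof.
move=> szA rootA; apply/eqP; rewrite -subr_eq0; apply/eqP.
apply: four_roots_eq0 => [|p hp]; last first.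
  by rewrite hornerD hornerN hornerZ rootA // root_quartic // mulr0 subr0.
apply/leq_sizeP => j; rewrite leq_eqVlt => /orP[/eqP<-|lt_j].
  by rewrite coefB coefZ quartic_lead mulr1 subrr.
rewrite coefB coefZ (nth_default _ (leq_trans szA lt_j)).
by rewrite [quartic`_j]nth_default ?size_quartic // mulr0 subrr.
Qed.

Lemma deriv_quartic_root p :
  p \in [:: p1; p2; p3; p4] -> quartic^`().[p] != 0.
Proof.
move=> hp; rewrite /quartic (big_rem p hp) derivM hornerD !hornerM.
rewrite derivB derivX derivC subr0 hornerXsubC subrr mul0r addr0 hornerC mul1r.
by rewrite -[_ == 0]/(root _ _) root_prod_XsubC mem_rem_uniq // !inE eqxx.
Qed.

Hypothesis degF : forall l, (size (F`_l)%R <= 7 - l)%N.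
Hypothesis degE : forall l, (size (E`_l)%R <= 7 - l)%N.
Hypothesis degH : forall l, (size (H`_l)%R <= 7 - l)%N.
Hypothesis at1 : holo_at p1 b1 F E H.
Hypothesis at2 : holo_at p2 b2 F E H.
Hypothesis at3 : holo_at p3 b3 E F H.
Hypothesis at4 : holo_at p4 b4 E F H.
Hypothesis H_inf : pole_free (- c) 0 (swapXY H).
Hypothesis D_inf : pole_free (- c) 0 (swapXY (F - E)).
Hypothesis F_inf : pole_free (- c) 2 ('X^2 *: swapXY F + (- c)%:P *: swapXY H).

(** The coefficient of z^l has degree at most 6 - l in x, which is less than four
when l is at least 3. *)
Lemma lead_coef_four_roots (Q : {poly {poly k}}) :
  (forall l, (size (Q`_l)%R <= 7 - l)%N) ->
  ((3 < size Q)%N -> {in [:: p1; p2; p3; p4], forall p, (lead_coef Q).[p] = 0}) ->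
  (size Q <= 3)%N.
Proof.
move=> degQ rootQ; case: leqP => // lt_3Q.
have : lead_coef Q = 0.
  apply: four_roots_eq0 (rootQ lt_3Q); rewrite lead_coefE (leq_trans (degQ _)) //.
  by move: lt_3Q; case: (size Q) => [|n] //=; lia.
by move/eqP; rewrite lead_coef_eq0 => /eqP Q0; rewrite Q0 size_poly0 in lt_3Q.
Qed.

Lemma forall_in_four (P : k -> Prop) :
  P p1 -> P p2 -> P p3 -> P p4 -> {in [:: p1; p2; p3; p4], forall p, P p}.
Proof. by move=> ? ? ? ? p; rewrite !inE => /or4P[] /eqP->. Qed.

Let leadF : (1 < size F)%N ->
  {in [:: p1; p2; p3; p4], forall p, (lead_coef F).[p] = 0}.
Proof.
move=> szF; case: at1 at2 at3 at4 => [_ ? _ _] [_ ? _ _] [_ _ ? _] [_ _ ? _].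
by apply: forall_in_four; apply: lead_coef_root szF; eassumption.
Qed.

Let leadE : (1 < size E)%N ->
  {in [:: p1; p2; p3; p4], forall p, (lead_coef E).[p] = 0}.
Proof.
move=> szE; case: at1 at2 at3 at4 => [_ _ ? _] [_ _ ? _] [_ ? _ _] [_ ? _ _].
by apply: forall_in_four; apply: lead_coef_root szE; eassumption.
Qed.

Lemma size_F_le3 : (size F <= 3)%N.
Proof. by apply: lead_coef_four_roots => // lt; apply: leadF; apply: leq_trans lt. Qed.

Lemma size_E_le3 : (size E <= 3)%N.
Proof. by apply: lead_coef_four_roots => // lt; apply: leadE; apply: leq_trans lt. Qed.

Lemma size_H_le3 : (size H <= 3)%N.
Proof.
apply: lead_coef_four_roots => // szH.
case: at1 at2 at3 at4 => [z1 _ _ h1] [z2 _ _ h2] [z3 _ _ h3] [z4 _ _ h4].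
apply: forall_in_four.
- exact: (lead_coef_root2 h1 size_F_le3).
- exact: (lead_coef_root2 h2 size_F_le3).
- exact: (lead_coef_root2 h3 size_E_le3).
- exact: (lead_coef_root2 h4 size_E_le3).
Qed.

(** The coefficient of z^2 has degree at most 4 and four roots, so it is a multiple of
the quartic, whose roots are simple. *)
Lemma size_le2_of_double_root (Q : {poly {poly k}}) p :
  (size Q <= 3)%N -> (forall l, (size (Q`_l)%R <= 7 - l)%N) ->
  ((1 < size Q)%N -> {in [:: p1; p2; p3; p4], forall p, (lead_coef Q).[p] = 0}) ->
  p \in [:: p1; p2; p3; p4] -> (Q`_2)^`().[p] = 0 -> (size Q <= 2)%N.
Proof.
move=> szQ degQ rootQ hp dQ; rewrite leqNgt; apply/negP => lt2.
have szQ3 : size Q = 3%N by apply/eqP; rewrite eqn_leq szQ.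
have rootQ2 : {in [:: p1; p2; p3; p4], forall p, (Q`_2).[p] = 0}.
  by have := rootQ (ltnW lt2); rewrite lead_coefE szQ3.
have [a Q2] : exists a, Q`_2 = a *: quartic.
  by exists (Q`_2)`_4; apply: four_roots_scale (degQ 2) rootQ2.
have /eqP : lead_coef Q = 0.
  rewrite lead_coefE szQ3 /= Q2; move/eqP: dQ.
  rewrite Q2 derivZ hornerZ mulf_eq0 (negPf (deriv_quartic_root hp)) orbF => /eqP->.
  by rewrite scale0r.
by rewrite lead_coef_eq0 -size_poly_eq0 szQ3.
Qed.

Lemma size_F_le2 : (size F <= 2)%N.
Proof.
apply: (size_le2_of_double_root size_F_le3 degF leadF (mem_head _ _)).
by case: at1 => z1 _ _ h1; apply: quadratic_part_deriv0 h1 size_F_le3 z1 size_H_le3.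
Qed.

Lemma size_E_le2 : (size E <= 2)%N.
Proof.
have p3P : p3 \in [:: p1; p2; p3; p4] by rewrite !inE eqxx !orbT.
apply: (size_le2_of_double_root size_E_le3 degE leadE p3P).
by case: at3 => z3 _ _ h3; apply: quadratic_part_deriv0 h3 size_E_le3 z3 size_H_le3.
Qed.

Let F2 : F`_2 = 0. Proof. by rewrite nth_default ?size_F_le2. Qed.
Let E2 : E`_2 = 0. Proof. by rewrite nth_default ?size_E_le2. Qed.

Let szD2 : (size (F - E)%R <= 2)%N.
Proof. by rewrite (leq_trans (size_polyD _ _)) // size_polyN geq_max size_F_le2 size_E_le2. Qed.

Let c'0 : - c != 0. Proof. by rewrite oppr_eq0. Qed.

Let inf_deg := infinity_degree c'0 H_inf F_inf size_F_le2 size_H_le3.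
Let dif_deg := difference_degree D_inf szD2.
Let inf_rel := infinity_relations c'0 F_inf size_F_le2 size_H_le3.

Let rootF1 : {in [:: p1; p2; p3; p4], forall p, (F`_1).[p] = 0}.
Proof.
case: at1 at2 at3 at4 => [_ h1 _ _] [_ h2 _ _] [_ _ h3 _] [_ _ h4 _].
by apply: forall_in_four; apply: linear_part_root size_F_le3 F2; eassumption.
Qed.

Let rootE1 : {in [:: p1; p2; p3; p4], forall p, (E`_1).[p] = 0}.
Proof.
case: at1 at2 at3 at4 => [_ _ h1 _] [_ _ h2 _] [_ h3 _ _] [_ h4 _ _].
by apply: forall_in_four; apply: linear_part_root size_E_le3 E2; eassumption.
Qed.

Definition leading : k := (F`_1)`_4.
Definition defect : k := ((F - E)`_0)`_0.
Notation L := leading.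
Notation u := defect.

Lemma F1E : F`_1 = L *: quartic.
Proof. by case: inf_deg => _ szF1 _; apply: four_roots_scale. Qed.

Let D1E : (F - E)`_1 = 0.
Proof.
case: dif_deg => _ szD1 _; apply: four_roots_eq0; first exact: leqW.
by move=> p hp; rewrite coefB hornerD hornerN rootF1 // rootE1 // subrr.
Qed.

Lemma E1E : E`_1 = F`_1.
Proof. by have /eqP := D1E; rewrite coefB subr_eq0 => /eqP->. Qed.

Lemma E0E : E`_0 = F`_0 - u%:P.
Proof.
suff : (F - E)`_0 = u%:P by rewrite coefB => <-; rewrite opprB addrC subrK.
case: dif_deg => szD0 _ D01; apply/polyP => -[|j]; rewrite coefC //=.
case: j => [|j]; first by rewrite D01 D1E coef0 mulr0 oppr0.
by rewrite nth_default // (leq_trans szD0).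
Qed.

Lemma sizeF0 : (size (F`_0)%R <= 4)%N. Proof. by case: inf_deg. Qed.

Lemma H2E : H`_2 *+ 2 = - (L *: quartic^`()).
Proof.
case: inf_deg => _ _ [_ _ szH2].
apply/eqP; rewrite -addr_eq0; apply/eqP; apply: four_roots_eq0.
  rewrite (leq_trans (size_polyD _ _)) // geq_max.
  rewrite mulr2n (leq_trans (size_polyD _ _)) ?maxnn //=.
  rewrite (leq_trans (size_scale_leq _ _)) //.
  by rewrite -ltnS (leq_trans (lt_size_deriv _)) // -?size_poly_eq0 size_quartic.
move=> p hp; rewrite hornerD hornerMn -derivZ -F1E; move: p hp.
case: at1 at2 at3 at4 => [z1 _ _ h1] [z2 _ _ h2] [z3 _ _ h3] [z4 _ _ h4].
apply: forall_in_four.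
- by have [-> _] := residue_relations h1 size_F_le3 z1 size_H_le3 F2; rewrite subrr.
- by have [-> _] := residue_relations h2 size_F_le3 z2 size_H_le3 F2; rewrite subrr.
- by rewrite -E1E; have [-> _] := residue_relations h3 size_E_le3 z3 size_H_le3 E2; rewrite subrr.
- by rewrite -E1E; have [-> _] := residue_relations h4 size_E_le3 z4 size_H_le3 E2; rewrite subrr.
Qed.

Let H2p p : (H`_2).[p] *+ 2 = - (L * quartic^`().[p]).
Proof. by rewrite -hornerMn H2E hornerN hornerZ. Qed.

Lemma F0_values :
  [/\ (F`_0).[p1] *+ 2 = - (b1 * (L * quartic^`().[p1])),
      (F`_0).[p2] *+ 2 = - (b2 * (L * quartic^`().[p2])),
      (F`_0).[p3] *+ 2 = u *+ 2 - b3 * (L * quartic^`().[p3])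
    & (F`_0).[p4] *+ 2 = u *+ 2 - b4 * (L * quartic^`().[p4])].
Proof.
case: at1 at2 at3 at4 => [z1 _ _ h1] [z2 _ _ h2] [z3 _ _ h3] [z4 _ _ h4].
split.
- have [_ ->] := residue_relations h1 size_F_le3 z1 size_H_le3 F2.
  by rewrite -mulrnAr H2p mulrN.
- have [_ ->] := residue_relations h2 size_F_le3 z2 size_H_le3 F2.
  by rewrite -mulrnAr H2p mulrN.
- have [_] := residue_relations h3 size_E_le3 z3 size_H_le3 E2.
  rewrite E0E hornerD hornerN hornerC => /eqP; rewrite subr_eq => /eqP->.
  by rewrite mulrnDl -mulrnAr H2p mulrN addrC.
- have [_] := residue_relations h4 size_E_le3 z4 size_H_le3 E2.
  rewrite E0E hornerD hornerN hornerC => /eqP; rewrite subr_eq => /eqP->.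
  by rewrite mulrnDl -mulrnAr H2p mulrN addrC.
Qed.

(** The subresidue relation at each pole reads F_0' + H_1 = 0 there: the term with
the residue cancels since 2 H_2 = - F_1' as polynomials. *)
Lemma H1E : H`_1 = - (F`_0)^`().
Proof.
case: inf_deg => szF0 _ [_ szH1 _].
apply/eqP; rewrite -addr_eq0; apply/eqP; apply: four_roots_eq0.
  rewrite (leq_trans (size_polyD _ _)) // geq_max leqW //=.
  by rewrite (leq_trans (size_poly _ _)) // (leq_trans (leq_pred _)).
have cancel p : (F`_1 \Po ('X + p%:P))`_2 + (H`_2)^`().[p] = 0.
  apply: (mulfI two_neq0); rewrite mulr0 mulr_natl mulrnDl coef2_translate F1E.
  by rewrite -hornerMn -derivMn H2E derivN derivZ hornerN -derivZ subrr.
have E0' : (E`_0)^`() = (F`_0)^`() by rewrite E0E derivB derivC subr0.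
case: at1 at2 at3 at4 => [z1 _ _ h1] [z2 _ _ h2] [z3 _ _ h3] [z4 _ _ h4].
move=> p hp; rewrite hornerD addrC; move: p hp; apply: forall_in_four.
- by have := subresidue_relation h1 size_F_le3 z1 size_H_le3 F2; rewrite cancel mulr0 addr0.
- by have := subresidue_relation h2 size_F_le3 z2 size_H_le3 F2; rewrite cancel mulr0 addr0.
- by have := subresidue_relation h3 size_E_le3 z3 size_H_le3 E2; rewrite E0' E1E cancel mulr0 addr0.
- by have := subresidue_relation h4 size_E_le3 z4 size_H_le3 E2; rewrite E0' E1E cancel mulr0 addr0.
Qed.

Lemma F0_lead : (F`_0)`_3 = c * L.
Proof.
case: inf_rel => _ + _; rewrite -/L => rel.
have := congr1 (fun W : {poly k} => W`_3) H2E.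
rewrite coefMn coefN coefZ coef_deriv quartic_lead => H23.
have -> : (F`_0)`_3 = ((F`_0)`_3 + - c * (H`_2)`_3) + c * (H`_2)`_3 by ring.
rewrite rel; apply: (mulfI two_neq0).
rewrite [LHS](_ : _ = 2 * - (- c * L *+ 3) + c * ((H`_2)`_3 *+ 2)); last by ring.
by rewrite H23; ring.
Qed.

Lemma H0E :
  H`_0 *+ 2 = (c ^+ 2 * L * quartic`_3 - c * (F`_0)`_2 *+ 2)%:P
              - (c ^+ 2 * L *+ 2) *: 'X.
Proof.
case: inf_rel => H01 _ H00; case: inf_deg => _ _ [szH0 _ _].
apply/polyP => -[|[|j]]; rewrite coefMn coefB coefC coefZ coefX /=.
- have H22 := congr1 (fun W : {poly k} => W`_2) H2E.
  move: H22; rewrite coefMn coefN coefZ coef_deriv => H22.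
  have H11 := congr1 (fun W : {poly k} => W`_1) H1E.
  move: H11; rewrite coefN coef_deriv => H11.
  rewrite H00 H11 F1E coefZ.
  rewrite [LHS](_ : _ = - c * (F`_0)`_2 *+ 2 - c ^+ 2 * ((H`_2)`_2 *+ 2)
      - c ^+ 2 * L * quartic`_3 *+ 2); last by ring.
  rewrite H22; ring.
- by rewrite H01 -/L; ring.
by rewrite nth_default ?(leq_trans szH0) // mul0rn mulr0 subr0.
Qed.

Lemma poly_size2 (Q : {poly {poly k}}) :
  (size Q <= 2)%N -> Q = (Q`_0)%:P + (Q`_1)%:P * 'X.
Proof.
move=> szQ; apply/polyP => -[|[|j]]; rewrite coefD coefC coefCM coefX /=.
- by rewrite mulr0 addr0.
- by rewrite mulr1 add0r.
by rewrite nth_default ?(leq_trans szQ) // mulr0 addr0.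
Qed.

(** The last five equations are one more than A has coefficients: this is the
condition on L and u that the interpolation formula makes explicit. *)
Theorem classification : exists A : {poly k},
  [/\ F = A%:P + (L *: quartic)%:P * 'X,
      E = F - u%:P%:P,
      H *+ 2 = - (L *: quartic^`())%:P * 'X^2 - (A^`() *+ 2)%:P * 'X
        + ((c ^+ 2 * L * quartic`_3 - c * A`_2 *+ 2)%:P - (c ^+ 2 * L *+ 2) *: 'X)%:P,
      (size A <= 4)%N /\ A`_3 = c * L
    & [/\ A.[p1] *+ 2 = - (b1 * (L * quartic^`().[p1])),
          A.[p2] *+ 2 = - (b2 * (L * quartic^`().[p2])),
          A.[p3] *+ 2 = u *+ 2 - b3 * (L * quartic^`().[p3])
        & A.[p4] *+ 2 = u *+ 2 - b4 * (L * quartic^`().[p4])]].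
Proof.
exists F`_0; split; last exact: F0_values.
- by rewrite -F1E -poly_size2 // size_F_le2.
- rewrite (poly_size2 size_E_le2) E1E E0E {3}(poly_size2 size_F_le2) polyCB; ring.
- apply/polyP => -[|[|[|j]]]; rewrite coefMn coefD coefB coefMXn coefMX coefN !coefC /=.
  + by rewrite subr0 add0r H0E.
  + by rewrite sub0r addr0 H1E mulNrn.
  + by rewrite subr0 addr0 H2E.
  by rewrite [H`__]nth_default ?(leq_trans size_H_le3) // mul0rn ?oppr0 ?subr0 ?addr0.
- by split; [exact: sizeF0 | exact: F0_lead].
Qed.

End Classification.

(** * The right-hand sides of the D4 system in the coordinates x, d, z *)
Section D4Expressions.
Variable A : comNzRingType.
Implicit Types x y z d eta b : A.

(** In the D4 system, L is - 2 D4slope and u is D4defect. *)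
Definition D4slope d eta : A := 2 * d + 1 - eta.
Definition D4defect d eta : A := d * (d - eta) * (d + 1) * (d + 1 - eta).

(** An interpolation polynomial at 0, eta, d and d + 1: the multiples of the slope come
from the residues b3, b0, b3, b1 at these points, and the last two terms from the
value u of the difference of the first two equations. *)
Definition D4cubic x d eta b0 b1 b3 : A :=
  D4slope d eta *
    (b3 * ((x - eta) * (x - d) * (x - (d + 1)))
     + b0 * (x * (x - d) * (x - (d + 1)))
     + b3 * (x * (x - eta) * (x - (d + 1)))
     + b1 * (x * (x - eta) * (x - d)))
  + (d * (d - eta)) * (x * (x - eta) * (x - d))
  - ((d + 1) * (d + 1 - eta)) * (x * (x - eta) * (x - (d + 1))).

(** Coefficients of x, x^2 and x^3 in x(x - eta)(x - d)(x - d - 1). *)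
Definition quartic1 d eta : A := - (eta * d * (d + 1)).
Definition quartic2 d eta : A := d * (d + 1) + eta * (2 * d + 1).
Definition quartic3 d eta : A := - (eta + 2 * d + 1).

Definition D4cubic0 d eta b3 : A := - (D4slope d eta * b3 * (eta * d * (d + 1))).
Definition D4cubic1 d eta b0 b1 b3 : A :=
  D4slope d eta * (b3 * quartic2 d eta + b0 * (d * (d + 1)) + b3 * (eta * (d + 1))
                   + b1 * (eta * d))
  + d * (d - eta) * (eta * d) - (d + 1) * (d + 1 - eta) * (eta * (d + 1)).
Definition D4cubic2 d eta b0 b1 b3 : A :=
  - (D4slope d eta * (b3 * (eta + 2 * d + 1) + b0 * (2 * d + 1) + b3 * (eta + d + 1)
                      + b1 * (eta + d)))
  - d * (d - eta) * (eta + d) + (d + 1) * (d + 1 - eta) * (eta + d + 1).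
(** The relation between the parameters makes the leading coefficient depend on b2
only; this is the leading coefficient forced by the pole at infinity. *)
Definition D4cubic3 d eta b2 : A := - (2 * b2 * D4slope d eta).

Variables eta b0 b1 b2 b3 : A.
Hypothesis sum_b : b0 + b1 + 2 * b2 + 2 * b3 = 1.

Let b0E : b0 = 1 - b1 - 2 * b2 - 2 * b3.
Proof.
by have -> : b0 = b0 + b1 + 2 * b2 + 2 * b3 - b1 - 2 * b2 - 2 * b3;
  [ring | rewrite sum_b].
Qed.

Lemma D4cubicE x d : D4cubic x d eta b0 b1 b3 =
  D4cubic3 d eta b2 * x ^+ 3 + D4cubic2 d eta b0 b1 b3 * x ^+ 2
  + D4cubic1 d eta b0 b1 b3 * x + D4cubic0 d eta b3.
Proof.
rewrite b0E /D4cubic /D4cubic3 /D4cubic2 /D4cubic1 /D4cubic0 /quartic2 /D4slope.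
by ring.
Qed.

Lemma D4PE x d z : D4P x (x - d) z eta b0 b3 b2 b1 b3 =
  D4cubic x d eta b0 b1 b3
  - 2 * D4slope d eta * (x * (x - eta) * (x - d) * (x - (d + 1))) * z.
Proof. by rewrite b0E /D4P /D4cubic /D4slope; ring. Qed.

Lemma D4QE x d z : - D4Q x (x - d) z eta b0 b3 b2 b1 b3 =
  D4P x (x - d) z eta b0 b3 b2 b1 b3 - D4defect d eta.
Proof. by rewrite b0E /D4P /D4Q /D4defect; ring. Qed.

Lemma D4RE x d z : 2 * D4R x (x - d) z eta b0 b3 b2 b1 b3 =
  2 * D4slope d eta * (4 * x ^+ 3 + 3 * quartic3 d eta * x ^+ 2
     + 2 * quartic2 d eta * x + quartic1 d eta) * z ^+ 2
  - 2 * (3 * D4cubic3 d eta b2 * x ^+ 2 + 2 * D4cubic2 d eta b0 b1 b3 * x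
         + D4cubic1 d eta b0 b1 b3) * z
  - 2 * b2 * D4cubic2 d eta b0 b1 b3
  - 2 * b2 ^+ 2 * D4slope d eta * quartic3 d eta
  + 4 * b2 ^+ 2 * D4slope d eta * x.
Proof.
rewrite b0E /D4R /D4cubic3 /D4cubic2 /D4cubic1 /quartic1 /quartic2 /quartic3 /D4slope.
by ring.
Qed.

End D4Expressions.

Section D4Morphism.
Variables (A B : comNzRingType) (f : {rmorphism A -> B}).

Let fE := (rmorphD f, rmorphB f, rmorphN f, rmorphM f, rmorphXn f, rmorph_nat f, rmorph1 f).

Lemma rmorph_D4P x y z eta a0 a1 a2 a3 a4 x' y' z' eta' a0' a1' a2' a3' a4' :
  f x = x' -> f y = y' -> f z = z' -> f eta = eta' ->
  f a0 = a0' -> f a1 = a1' -> f a2 = a2' -> f a3 = a3' -> f a4 = a4' ->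
  f (D4P x y z eta a0 a1 a2 a3 a4) = D4P x' y' z' eta' a0' a1' a2' a3' a4'.
Proof. by do 9!move=> <-; rewrite /D4P !fE. Qed.

Lemma rmorph_D4Q x y z eta a0 a1 a2 a3 a4 x' y' z' eta' a0' a1' a2' a3' a4' :
  f x = x' -> f y = y' -> f z = z' -> f eta = eta' ->
  f a0 = a0' -> f a1 = a1' -> f a2 = a2' -> f a3 = a3' -> f a4 = a4' ->
  f (D4Q x y z eta a0 a1 a2 a3 a4) = D4Q x' y' z' eta' a0' a1' a2' a3' a4'.
Proof. by do 9!move=> <-; rewrite /D4Q !fE. Qed.

Lemma rmorph_D4R x y z eta a0 a1 a2 a3 a4 x' y' z' eta' a0' a1' a2' a3' a4' :
  f x = x' -> f y = y' -> f z = z' -> f eta = eta' ->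
  f a0 = a0' -> f a1 = a1' -> f a2 = a2' -> f a3 = a3' -> f a4 = a4' ->
  f (D4R x y z eta a0 a1 a2 a3 a4) = D4R x' y' z' eta' a0' a1' a2' a3' a4'.
Proof. by do 9!move=> <-; rewrite /D4R !fE. Qed.

Lemma rmorph_D4slope d eta : f (D4slope d eta) = D4slope (f d) (f eta).
Proof. by rewrite /D4slope !fE. Qed.
Lemma rmorph_D4defect d eta : f (D4defect d eta) = D4defect (f d) (f eta).
Proof. by rewrite /D4defect !fE. Qed.
Lemma rmorph_D4cubic x d eta b0 b1 b3 :
  f (D4cubic x d eta b0 b1 b3) = D4cubic (f x) (f d) (f eta) (f b0) (f b1) (f b3).
Proof. by rewrite /D4cubic /D4slope !fE. Qed.
Lemma rmorph_D4cubic1 d eta b0 b1 b3 :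
  f (D4cubic1 d eta b0 b1 b3) = D4cubic1 (f d) (f eta) (f b0) (f b1) (f b3).
Proof. by rewrite /D4cubic1 /quartic2 /D4slope !fE. Qed.
Lemma rmorph_D4cubic2 d eta b0 b1 b3 :
  f (D4cubic2 d eta b0 b1 b3) = D4cubic2 (f d) (f eta) (f b0) (f b1) (f b3).
Proof. by rewrite /D4cubic2 /D4slope !fE. Qed.
Lemma rmorph_D4cubic3 d eta b2 : f (D4cubic3 d eta b2) = D4cubic3 (f d) (f eta) (f b2).
Proof. by rewrite /D4cubic3 /D4slope !fE. Qed.
Lemma rmorph_D4cubic0 d eta b3 : f (D4cubic0 d eta b3) = D4cubic0 (f d) (f eta) (f b3).
Proof. by rewrite /D4cubic0 /D4slope !fE. Qed.
Lemma rmorph_quartic1 d eta : f (quartic1 d eta) = quartic1 (f d) (f eta).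
Proof. by rewrite /quartic1 !fE. Qed.
Lemma rmorph_quartic2 d eta : f (quartic2 d eta) = quartic2 (f d) (f eta).
Proof. by rewrite /quartic2 !fE. Qed.
Lemma rmorph_quartic3 d eta : f (quartic3 d eta) = quartic3 (f d) (f eta).
Proof. by rewrite /quartic3 !fE. Qed.
End D4Morphism.

(** * Interpolation: the solutions of the classification *)
Section D4Solution.
Variable k : fieldType.
Variables eta d b0 b1 b2 b3 : k.
Hypothesis sum_b : b0 + b1 + 2 * b2 + 2 * b3 = 1.
Let ps := [:: 0; eta; d; d + 1].
Notation G := (quartic 0 eta d (d + 1)).
Notation S := (D4slope d eta).

Lemma quarticE : G = 'X^4 + (quartic3 d eta)%:P * 'X^3 + (quartic2 d eta)%:P * 'X^2
  + (quartic1 d eta)%:P * 'X.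
Proof.
rewrite /quartic !big_cons big_nil mulr1 /quartic1 /quartic2 /quartic3.
by rewrite !(polyCD, polyCM, polyCN, polyC1, polyC_natr, polyC0); ring.
Qed.

Lemma deriv_quartic : G^`() = 4%:P * 'X^3 + (3 * quartic3 d eta)%:P * 'X^2
  + (2 * quartic2 d eta)%:P * 'X + (quartic1 d eta)%:P.
Proof.
rewrite quarticE !(derivD, derivM, derivXn, derivX, derivC) /=.
by rewrite !(polyCM, polyC_natr); ring.
Qed.

Lemma coef3_quartic : G`_3 = quartic3 d eta.
Proof.
by rewrite quarticE !(coefD, coefXn, coefCM, coefX) /=; ring.
Qed.

Hypothesis two_neq0 : 2 != 0 :> k.
Hypothesis ps_uniq : uniq [:: 0; eta; d; d + 1].

Lemma quartic_deriv_values :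
  [/\ G^`().[0] = - (eta * d * (d + 1)),
      G^`().[eta] = eta * (eta - d) * (eta - (d + 1)),
      G^`().[d] = - (d * (d - eta))
    & G^`().[d + 1] = (d + 1) * (d + 1 - eta)].
Proof.
rewrite deriv_quartic !(hornerD, hornerM, hornerXn, hornerX, hornerC).
rewrite /quartic1 /quartic2 /quartic3; split; ring.
Qed.

Lemma horner_size4 (A : {poly k}) p : (size A <= 4)%N ->
  A.[p] = A`_0 + A`_1 * p + A`_2 * p ^+ 2 + A`_3 * p ^+ 3.
Proof.
move=> szA; rewrite (horner_coef_wide _ szA) !big_ord_recl big_ord0 /= /bump /=.
by rewrite addr0 expr0 mulr1 expr1 !addrA.
Qed.

Let ps_diff : [/\ eta != 0, d != 0, d + 1 != 0 & (d - eta != 0) && (d + 1 - eta != 0)].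
Proof.
move: ps_uniq; rewrite /= !inE !negb_or => /and4P[/and3P[n1 n2 n3] /andP[n4 n5] _ _].
by split; rewrite ?subr_eq0 1?eq_sym // n4 eq_sym n5.
Qed.

Section Values.
Variables (A : {poly k}) (L u : k).
Hypothesis szA : (size A <= 4)%N.
Hypothesis leadA : A`_3 = b2 * L.
Hypothesis A0 : A.[0] *+ 2 = - (b3 * (L * G^`().[0])).
Hypothesis Aeta : A.[eta] *+ 2 = - (b0 * (L * G^`().[eta])).
Hypothesis Ad : A.[d] *+ 2 = u *+ 2 - b3 * (L * G^`().[d]).
Hypothesis Ad1 : A.[d + 1] *+ 2 = u *+ 2 - b1 * (L * G^`().[d + 1]).

(** The sum of A(p)/G'(p) over the four roots p of G is the coefficient of x^3 in A.
Inserting the prescribed values, the terms with L add up to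
(b0 + b1 + 2 b2 + 2 b3) L, and the terms with u to
2u (1/G'(d) + 1/G'(d+1)). *)
Lemma lagrange_relation : L * D4defect d eta = - (2 * S * u).
Proof.
have [eta0 d0 d10 /andP[de d1e]] := ps_diff.
have [g0 ge gd gd1] := quartic_deriv_values.
have ed : eta - d != 0 by rewrite -opprB oppr_eq0.
have ed1 : eta - (d + 1) != 0 by rewrite -opprB oppr_eq0.
have lagrange : (A.[0] / G^`().[0] + A.[eta] / G^`().[eta]
    + A.[d] / G^`().[d] + A.[d + 1] / G^`().[d + 1]) = A`_3.
  rewrite g0 ge gd gd1 !(horner_size4 _ szA); field.
  by rewrite d1e d10 ed1 ed eta0 !oppr_eq0 !mulf_neq0.
have value (a g r v : k) : g != 0 -> a *+ 2 = v - r * (L * g) ->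
    2 * (a / g) = v / g - r * L.
  by move=> gn0 E; rewrite mulrA mulr_natl E; field.
have gn0 p : p \in ps -> G^`().[p] != 0 by apply: deriv_quartic_root.
have v0 : 2 * (A.[0] / G^`().[0]) = 0 / G^`().[0] - b3 * L.
  by apply: value; [apply: gn0; rewrite !inE eqxx | rewrite A0 sub0r].
have ve : 2 * (A.[eta] / G^`().[eta]) = 0 / G^`().[eta] - b0 * L.
  by apply: value; [apply: gn0; rewrite !inE eqxx orbT | rewrite Aeta sub0r].
have vd : 2 * (A.[d] / G^`().[d]) = u *+ 2 / G^`().[d] - b3 * L.
  by apply: value => //; apply: gn0; rewrite !inE eqxx !orbT.
have vd1 : 2 * (A.[d + 1] / G^`().[d + 1]) = u *+ 2 / G^`().[d + 1] - b1 * L.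
  by apply: value => //; apply: gn0; rewrite !inE eqxx !orbT.
have := congr1 (fun a => 2 * a) lagrange; rewrite leadA !mulrDr v0 ve vd vd1.
rewrite !mul0r !sub0r gd gd1 => E.
have Lu : L * (b0 + b1 + 2 * b2 + 2 * b3) =
    u *+ 2 / - (d * (d - eta)) + u *+ 2 / ((d + 1) * (d + 1 - eta)).
  rewrite [LHS](_ : _ = 2 * (b2 * L) + (b3 + b0 + b3 + b1) * L); last by ring.
  by rewrite -E; ring.
move: Lu; rewrite sum_b mulr1 => ->; rewrite /D4defect /D4slope; field.
by rewrite ?eta0 ?d0 ?d10 ?de ?d1e ?oppr_eq0 ?mulf_neq0.
Qed.

Lemma degenerate_solution : S != 0 -> L = 0 -> A = 0.
Proof.
move=> S0 L0; have u0 : u = 0.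
  apply: (mulfI (mulf_neq0 two_neq0 S0)); apply: oppr_inj.
  by rewrite mulr0 oppr0 -lagrange_relation L0 mul0r.
have half0 (a : k) : a *+ 2 = 0 -> a = 0.
  by move=> a0; apply: (mulfI two_neq0); rewrite mulr0 mulr_natl.
apply: (four_roots_eq0 ps_uniq szA); apply: forall_in_four; apply: half0.
- by rewrite A0 L0 mul0r mulr0 oppr0.
- by rewrite Aeta L0 mul0r mulr0 oppr0.
- by rewrite Ad L0 u0 mul0r mulr0 mul0rn subr0.
- by rewrite Ad1 L0 u0 mul0r mulr0 mul0rn subr0.
Qed.

Lemma scaling_factor (c kappa : k) : S != 0 -> c != 0 -> L = c * S ->
  kappa * c = - 2 -> kappa * L = - (2 * S) /\ kappa * u = D4defect d eta.
Proof.
move=> S0 c0 LE kc; split; first by rewrite LE mulrA kc mulNr.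
have rel : c * D4defect d eta = - (2 * u).
  apply: (mulfI S0); rewrite mulrA [S * c]mulrC -LE lagrange_relation; ring.
by apply: (mulfI c0); rewrite mulrA [c * kappa]mulrC kc rel mulNr.
Qed.

Variable kappa : k.
Hypothesis kappaL : kappa * L = - (2 * S).
Hypothesis kappau : kappa * u = D4defect d eta.

Definition D4cubic_poly : {poly k} :=
  (D4cubic3 d eta b2)%:P * 'X^3 + (D4cubic2 d eta b0 b1 b3)%:P * 'X^2
  + (D4cubic1 d eta b0 b1 b3)%:P * 'X + (D4cubic0 d eta b3)%:P.

Lemma horner_D4cubic p : D4cubic_poly.[p] = D4cubic p d eta b0 b1 b3.
Proof.
by rewrite (D4cubicE eta sum_b) /D4cubic_poly !(hornerD, hornerM, hornerXn, hornerX, hornerC).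
Qed.

Lemma coef_D4cubic i : D4cubic_poly`_i =
  nth 0 [:: D4cubic0 d eta b3; D4cubic1 d eta b0 b1 b3; D4cubic2 d eta b0 b1 b3;
            D4cubic3 d eta b2] i.
Proof.
rewrite /D4cubic_poly !(coefD, coefCM, coefXn, coefX, coefC).
by case: i => [|[|[|[|i]]]] /=; rewrite ?nth_nil; ring.
Qed.

Lemma deriv_D4cubic : D4cubic_poly^`() =
  (3 * D4cubic3 d eta b2)%:P * 'X^2 + (2 * D4cubic2 d eta b0 b1 b3)%:P * 'X
  + (D4cubic1 d eta b0 b1 b3)%:P.
Proof.
rewrite /D4cubic_poly !(derivD, derivM, derivXn, derivX, derivC) /=.
by rewrite !(polyCM, polyC_natr); ring.
Qed.

(** Both sides have degree at most 3 and the same values at the four roots. *)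
Lemma scaled_cubic : kappa *: A = D4cubic_poly.
Proof.
have [g0 ge gd gd1] := quartic_deriv_values.
have szM : (size D4cubic_poly <= 4)%N.
  by apply/leq_sizeP => j le_j; rewrite coef_D4cubic nth_default.
apply/eqP; rewrite -subr_eq0; apply/eqP; apply: (four_roots_eq0 ps_uniq).
  rewrite (leq_trans (size_polyD _ _)) // geq_max size_polyN szM andbT.
  exact: leq_trans (size_scale_leq _ _) szA.
have cancel (a v m : k) : a *+ 2 = v -> kappa * v = 2 * m -> kappa * a - m = 0.
  move=> av vm; apply: (mulfI two_neq0); rewrite mulr0 mulrBr -vm -av; ring.
apply: forall_in_four; rewrite hornerD hornerN hornerZ horner_D4cubic.
- apply: (cancel _ _ _ A0); rewrite g0.
  rewrite [LHS](_ : _ = b3 * (kappa * L) * (eta * d * (d + 1))); last by ring.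
  by rewrite kappaL /D4cubic; ring.
- apply: (cancel _ _ _ Aeta); rewrite ge.
  rewrite [LHS](_ : _ = - b0 * (kappa * L) * (eta * (eta - d) * (eta - (d + 1)))); last by ring.
  by rewrite kappaL /D4cubic; ring.
- apply: (cancel _ _ _ Ad); rewrite gd.
  rewrite [LHS](_ : _ = 2 * (kappa * u) + b3 * (kappa * L) * (d * (d - eta))); last by ring.
  by rewrite kappaL kappau /D4defect /D4cubic /D4slope; ring.
apply: (cancel _ _ _ Ad1); rewrite gd1.
rewrite [LHS](_ : _ = 2 * (kappa * u) - b1 * (kappa * L) * ((d + 1) * (d + 1 - eta))); last by ring.
by rewrite kappaL kappau /D4defect /D4cubic /D4slope; ring.
Qed.

Let sum_bC : b0%:P + b1%:P + 2 * b2%:P + 2 * b3%:P = 1 :> {poly k}.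
Proof.
have E1 : (b0 + b1 + 2 * b2 + 2 * b3)%:P = 1 :> {poly k} by rewrite sum_b.
by rewrite -[RHS]E1 !(polyCD, polyCM, polyC_natr).
Qed.

Lemma D4cubic_polyE : D4cubic_poly = D4cubic 'X d%:P eta%:P b0%:P b1%:P b3%:P.
Proof.
rewrite (D4cubicE eta%:P sum_bC) /D4cubic_poly.
by rewrite rmorph_D4cubic3 rmorph_D4cubic2 rmorph_D4cubic1 rmorph_D4cubic0.
Qed.

Lemma quartic_prodE : G = 'X * ('X - eta%:P) * ('X - d%:P) * ('X - (d%:P + 1)).
Proof. by rewrite /quartic !big_cons big_nil polyC0 subr0 polyCD polyC1 mulr1 !mulrA. Qed.

(** The identification takes place in any commutative ring B that receives k[x] and
contains an element z. *)
Section Lift.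
Variables (B : comNzRingType) (lift : {rmorphism {poly k} -> B}) (z : B).
Notation cc a := (lift a%:P).
Notation X := (lift 'X).

Let liftE := (rmorphD lift, rmorphB lift, rmorphN lift, rmorphM lift, rmorphXn lift,
  rmorph_nat lift, rmorph1 lift).

Let slopeE a b : lift (D4slope a b)%:P = D4slope (cc a) (cc b).
Proof. by rewrite (rmorph_D4slope (@polyC k)) (rmorph_D4slope lift). Qed.
Let defectE a b : lift (D4defect a b)%:P = D4defect (cc a) (cc b).
Proof. by rewrite (rmorph_D4defect (@polyC k)) (rmorph_D4defect lift). Qed.
Let cubic1E a b r q p : lift (D4cubic1 a b r q p)%:P = D4cubic1 (cc a) (cc b) (cc r) (cc q) (cc p).
Proof. by rewrite (rmorph_D4cubic1 (@polyC k)) (rmorph_D4cubic1 lift). Qed.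
Let cubic2E a b r q p : lift (D4cubic2 a b r q p)%:P = D4cubic2 (cc a) (cc b) (cc r) (cc q) (cc p).
Proof. by rewrite (rmorph_D4cubic2 (@polyC k)) (rmorph_D4cubic2 lift). Qed.
Let cubic3E a b p : lift (D4cubic3 a b p)%:P = D4cubic3 (cc a) (cc b) (cc p).
Proof. by rewrite (rmorph_D4cubic3 (@polyC k)) (rmorph_D4cubic3 lift). Qed.
Let quartic1E a b : lift (quartic1 a b)%:P = quartic1 (cc a) (cc b).
Proof. by rewrite (rmorph_quartic1 (@polyC k)) (rmorph_quartic1 lift). Qed.
Let quartic2E a b : lift (quartic2 a b)%:P = quartic2 (cc a) (cc b).
Proof. by rewrite (rmorph_quartic2 (@polyC k)) (rmorph_quartic2 lift). Qed.
Let quartic3E a b : lift (quartic3 a b)%:P = quartic3 (cc a) (cc b).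
Proof. by rewrite (rmorph_quartic3 (@polyC k)) (rmorph_quartic3 lift). Qed.
Let liftnM n a : cc (n%:R * a) = n%:R * cc a.
Proof. by rewrite polyCM polyC_natr (rmorphM lift) (rmorph_nat lift). Qed.
Let liftCN a : cc (- a) = - cc a.
Proof. by rewrite polyCN (rmorphN lift). Qed.
Let liftCM a b : cc (a * b) = cc a * cc b.
Proof. by rewrite polyCM (rmorphM lift). Qed.
Let liftn n : cc n%:R = n%:R.
Proof. by rewrite polyC_natr (rmorph_nat lift). Qed.

Let sum_cc : cc b0 + cc b1 + 2 * cc b2 + 2 * cc b3 = 1.
Proof.
have E1 : lift (b0%:P + b1%:P + 2 * b2%:P + 2 * b3%:P) = 1.
  by rewrite sum_bC (rmorph1 lift).
by rewrite -[RHS]E1 !liftE.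
Qed.

Let liftZ a Q : cc a * lift Q = lift (a *: Q).
Proof. by rewrite -(rmorphM lift) mul_polyC. Qed.

Let scaled_slope : cc kappa * lift (L *: G) = - (2 * D4slope (cc d) (cc eta) *
  (X * (X - cc eta) * (X - cc d) * (X - (cc d + 1)))).
Proof.
rewrite liftZ scalerA kappaL -mul_polyC quartic_prodE polyCN polyCM polyC_natr.
by rewrite mulNr !liftE slopeE.
Qed.

Let scaled_constant : cc kappa * lift A =
  D4cubic X (cc d) (cc eta) (cc b0) (cc b1) (cc b3).
Proof. by rewrite liftZ scaled_cubic D4cubic_polyE (rmorph_D4cubic lift). Qed.

Lemma scaled_F : cc kappa * (lift A + lift (L *: G) * z) =
  D4P X (X - cc d) z (cc eta) (cc b0) (cc b3) (cc b2) (cc b1) (cc b3).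
Proof.
rewrite (D4PE (cc eta) sum_cc) mulrDr scaled_constant mulrA scaled_slope.
by rewrite !mulNr.
Qed.

Lemma scaled_E : - (cc kappa * (lift A + lift (L *: G) * z - cc u)) =
  D4Q X (X - cc d) z (cc eta) (cc b0) (cc b3) (cc b2) (cc b1) (cc b3).
Proof.
have defect_u : cc kappa * cc u = D4defect (cc d) (cc eta).
  by rewrite -(rmorphM lift) -polyCM kappau defectE.
by apply: oppr_inj; rewrite opprK (D4QE (cc eta) sum_cc) mulrBr scaled_F defect_u.
Qed.

Let scaled_deriv : cc kappa * lift A^`() =
  3 * D4cubic3 (cc d) (cc eta) (cc b2) * X ^+ 2
  + 2 * D4cubic2 (cc d) (cc eta) (cc b0) (cc b1) (cc b3) * X
  + D4cubic1 (cc d) (cc eta) (cc b0) (cc b1) (cc b3).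
Proof.
rewrite liftZ -derivZ scaled_cubic deriv_D4cubic.
rewrite !(rmorphD lift) [lift (_%:P * 'X^2)](rmorphM lift).
rewrite [lift (_%:P * 'X)](rmorphM lift) (rmorphXn lift) !liftnM.
by rewrite cubic3E cubic2E cubic1E.
Qed.

Let scaled_lead_deriv : cc kappa * lift (L *: G^`()) =
  - (2 * D4slope (cc d) (cc eta) * (4 * X ^+ 3 + 3 * quartic3 (cc d) (cc eta) * X ^+ 2
     + 2 * quartic2 (cc d) (cc eta) * X + quartic1 (cc d) (cc eta))).
Proof.
rewrite liftZ scalerA kappaL -mul_polyC deriv_quartic.
rewrite (rmorphM lift) !(rmorphD lift) [lift (_%:P * 'X^3)](rmorphM lift).
rewrite [lift (_%:P * 'X^2)](rmorphM lift) [lift (_%:P * 'X)](rmorphM lift) !(rmorphXn lift).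
by rewrite [cc (- (2 * _))]liftCN !liftnM liftn slopeE quartic3E quartic2E quartic1E mulNr.
Qed.

(** Only 2H is known from the classification, hence the factor 2 on both sides. *)
Lemma scaled_H (h : B) :
  2 * h = - lift (L *: G^`()) * z ^+ 2 - lift (A^`() *+ 2) * z
    + lift ((b2 ^+ 2 * L * G`_3 - b2 * A`_2 *+ 2)%:P - (b2 ^+ 2 * L *+ 2) *: 'X) ->
  2 * (cc kappa * h) =
  2 * D4R X (X - cc d) z (cc eta) (cc b0) (cc b3) (cc b2) (cc b1) (cc b3).
Proof.
move=> hE; rewrite mulrCA hE 2!mulrDr (D4RE (cc eta) sum_cc).
have -> : cc kappa * (- lift (L *: G^`()) * z ^+ 2) =
    - (cc kappa * lift (L *: G^`())) * z ^+ 2 by ring.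
rewrite scaled_lead_deriv (rmorphMn lift).
have -> : cc kappa * - (lift A^`() *+ 2 * z) = - (2 * (cc kappa * lift A^`()) * z) by ring.
rewrite scaled_deriv.
have A2 : kappa * A`_2 = D4cubic2 d eta b0 b1 b3.
  by rewrite -coefZ scaled_cubic coef_D4cubic.
have -> : cc kappa * lift ((b2 ^+ 2 * L * G`_3 - b2 * A`_2 *+ 2)%:P
      - (b2 ^+ 2 * L *+ 2) *: 'X) =
    - (2 * cc b2 * D4cubic2 (cc d) (cc eta) (cc b0) (cc b1) (cc b3))
    - 2 * cc b2 ^+ 2 * D4slope (cc d) (cc eta) * quartic3 (cc d) (cc eta)
    + 4 * cc b2 ^+ 2 * D4slope (cc d) (cc eta) * X.
  rewrite liftZ scalerBr scalerA -!mul_polyC -polyCM coef3_quartic.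
  have -> : kappa * (b2 ^+ 2 * L * quartic3 d eta - b2 * A`_2 *+ 2) =
      b2 ^+ 2 * (kappa * L) * quartic3 d eta - 2 * b2 * (kappa * A`_2) by ring.
  have -> : kappa * (b2 ^+ 2 * L *+ 2) = 2 * b2 ^+ 2 * (kappa * L) by ring.
  rewrite A2 kappaL !(rmorphB lift, rmorphM lift) polyCB (rmorphB lift).
  rewrite !liftCM [cc (- (2 * _))]liftCN liftnM !liftn.
  by rewrite slopeE cubic2E quartic3E; ring.
by ring.
Qed.
End Lift.

End Values.
End D4Solution.

(** * Specialization of fractions *)
Section Specialization.
Variables (A : idomainType) (S : fieldType) (phi : {rmorphism A -> S}).

Notation L := (frac_field A).

(** A partial map on fractions, given as a relation: it is defined on the fractions
with a denominator that phi does not kill. *)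
Definition specializes (u : L) (e : S) : Prop :=
  exists n m, [/\ phi m != 0, u = (n%:F : L) / m%:F & e = phi n / phi m].

Let denom_neq0 m : phi m != 0 -> (m%:F : L) != 0.
Proof. by rewrite tofrac_eq0; apply: contraNneq => ->; rewrite rmorph0. Qed.

Lemma specializes_uniq u e e' : specializes u e -> specializes u e' -> e = e'.
Proof.
move=> [n [m [m0 -> ->]]] [n' [m' [m'0 E ->]]].
move/eqP: E; rewrite eqr_div ?denom_neq0 // -!rmorphM tofrac_eq => /eqP E.
by apply/eqP; rewrite eqr_div // -!rmorphM E.
Qed.

Lemma specializes_neq0 u e : e != 0 -> specializes u e -> u != 0.
Proof.
move=> e0 [n [m [m0 -> eE]]]; rewrite mulf_neq0 ?invr_eq0 ?denom_neq0 //.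
by move: e0; rewrite eE mulf_eq0 negb_or => /andP[].
Qed.

Lemma specializes_tofrac p : specializes (p%:F : L) (phi p).
Proof. by exists p, 1; rewrite !rmorph1 oner_neq0 !divr1. Qed.

Lemma specializes_tofracE p e : phi p = e -> specializes (p%:F : L) e.
Proof. by move<-; apply: specializes_tofrac. Qed.

Lemma specializesD u v e e' :
  specializes u e -> specializes v e' -> specializes (u + v) (e + e').
Proof.
move=> [n [m [m0 -> ->]]] [n' [m' [m'0 -> ->]]].
exists (n * m' + n' * m), (m * m').
rewrite !rmorphD !rmorphM /= mulf_neq0 //; split=> //.
  by rewrite addf_div ?denom_neq0.
by rewrite addf_div.
Qed.

Lemma specializesM u v e e' :
  specializes u e -> specializes v e' -> specializes (u * v) (e * e').
Proof.
move=> [n [m [m0 -> ->]]] [n' [m' [m'0 -> ->]]].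
exists (n * n'), (m * m').
by rewrite !rmorphM /= mulf_neq0 // !mulf_div.
Qed.

Lemma specializesN u e : specializes u e -> specializes (- u) (- e).
Proof.
move=> [n [m [m0 -> ->]]]; exists (- n), m.
by rewrite !rmorphN !mulNr.
Qed.

Lemma specializesV u e : e != 0 -> specializes u e -> specializes u^-1 e^-1.
Proof.
move=> e0 [n [m [m0 -> eE]]]; exists m, n.
have n0 : phi n != 0 by move: e0; rewrite eE mulf_eq0 negb_or => /andP[].
by rewrite n0 eE !invf_div.
Qed.

Lemma specializes1 : specializes 1 1.
Proof. by have := specializes_tofrac 1; rewrite !rmorph1. Qed.

Lemma specializesX u e n : specializes u e -> specializes (u ^+ n) (e ^+ n).
Proof.
move=> ue; elim: n => [|n IH]; first exact: specializes1.
by rewrite !exprS; apply: specializesM.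
Qed.

End Specialization.

(** * The coordinates x, d, z *)
Section Chart.
Variable K : fieldType.
Notation k := (frac_field {poly K}).

Definition const_d : K -> k := (@FracField.tofrac _) \o polyC.
HB.instance Definition _ :=
  GRing.RMorphism.copy const_d ((@FracField.tofrac _) \o polyC).

Definition var_d : k := 'X%:F.

Definition const_dxz : K -> {poly {poly k}} := polyC \o polyC \o const_d.
HB.instance Definition _ :=
  GRing.RMorphism.copy const_dxz (polyC \o polyC \o const_d).

(** The order of the variables in the target is d (a scalar), x (inner), z (outer). *)
Definition chart : {mpoly K[3]} -> {poly {poly k}} :=
  mmap const_dxz (tnth [tuple 'X%:P; ('X - var_d%:P)%:P; 'X]).
HB.instance Definition _ :=
  GRing.RMorphism.copy chart (mmap const_dxz (tnth [tuple 'X%:P; ('X - var_d%:P)%:P; 'X])).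

Lemma chartC c : chart c%:MP = (const_d c)%:P%:P.
Proof. by rewrite /chart mmapC. Qed.

Lemma chart_x : chart 'X_(inord 0) = 'X%:P.
Proof. by rewrite /chart mmapX mmap1U (tnth_nth 0) inordK. Qed.

Lemma chart_y : chart 'X_(inord 1) = ('X - var_d%:P)%:P.
Proof. by rewrite /chart mmapX mmap1U (tnth_nth 0) inordK. Qed.

Lemma chart_z : chart 'X_(inord 2) = 'X.
Proof. by rewrite /chart mmapX mmap1U (tnth_nth 0) inordK. Qed.

End Chart.

(** As for [frac_field], the name stops the unfolding of structures. *)
Definition xyz_ring (R : realType) : idomainType := poly_xyz R.

Section Regularity.
Variable R : realType.
Notation K := (frac_field {poly R[i]}).
Notation k := (frac_field {poly K}).
Notation E := (frac_field {poly {poly k}}).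
Notation iota := (@blow_const k).

Definition chart_xyz : poly_xyz R -> {poly {poly k}} := @chart K.
HB.instance Definition _ := GRing.RMorphism.copy chart_xyz (@chart K).

Section At.
Variables (x z : E).

Definition chart_fun : poly_xyz R -> E := ev2 iota x z \o chart_xyz.
HB.instance Definition _ := GRing.RMorphism.copy chart_fun (ev2 iota x z \o chart_xyz).
Definition chart_at : {rmorphism xyz_ring R -> E} := chart_fun.

Lemma chart_atC c : chart_at (cst_xyz c) = iota (const_d (cst_t c : K)).
Proof. by rewrite /= /chart_fun /= [chart_xyz _]chartC ev2C ev1C. Qed.

Lemma chart_at_x : chart_at (vx R) = x.
Proof. by rewrite /= /chart_fun /= [chart_xyz _]chart_x ev2C ev1X. Qed.

Lemma chart_at_y : chart_at (vy R) = x - iota (var_d K).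
Proof. by rewrite /= /chart_fun /= [chart_xyz _]chart_y ev2C rmorphB /= ev1X ev1C. Qed.

Lemma chart_at_z : chart_at (vz R) = z.
Proof. by rewrite /= /chart_fun /= [chart_xyz _]chart_z ev2X. Qed.

Lemma chart_at_const (a : K) : regular (chart_at (a%:MP : poly_xyz R)).
Proof. by rewrite /= /chart_fun /= [chart_xyz _]chartC ev2C ev1C; apply: regular_const. Qed.

End At.
End Regularity.

(** * From polynomiality in a chart to regularity *)
Section Substitution.
Variables (R : realType) (S : fieldType) (phi : {rmorphism xyz_ring R -> S}).
Notation K := (ratfun_t R).

Lemma specializes_subst w (e : 3.-tuple S) (g : poly_xyz R) :
  (forall j, specializes phi (tnth w j) (tnth e j)) ->
  specializes phi (subst_xyz w g) (mmap (fun a : K => phi a%:MP) (tnth e) g).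
Proof.
move=> we; rewrite /subst_xyz /mmap.
apply: (big_ind2 (specializes phi)) => [|? ? ? ?|m _].
- by have := specializes_tofrac phi 0; rewrite !rmorph0.
- exact: specializesD.
apply: specializesM; first exact: specializes_tofrac.
apply: (big_ind2 (specializes phi)) => [|? ? ? ?|i _].
- exact: specializes1.
- exact: specializesM.
exact: specializesX (we i).
Qed.

(** If the chart coordinates specialize into a subring that contains the constants,
then so do their derivatives, being polynomials in the coordinates. *)
Lemma polynomial_in_closed (reg : S -> Prop) f w (e : 3.-tuple S) :
  (forall c : K, reg (phi c%:MP)) ->
  (forall a b, reg a -> reg b -> reg (a + b)) ->
  (forall a b, reg a -> reg b -> reg (a * b)) ->
  polynomial_in f w ->
  (forall j, specializes phi (tnth w j) (tnth e j)) ->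
  (forall j, reg (tnth e j)) ->
  forall j q, specializes phi (total_der f (tnth w j)) q -> reg q.
Proof.
move=> regC regD regM [g gE] we re j q; rewrite gE => spec_q.
have r0 : reg 0 by have := regC 0; rewrite mpolyC0 rmorph0.
have r1 : reg 1 by have := regC 1; rewrite mpolyC1 rmorph1.
rewrite (specializes_uniq spec_q (specializes_subst (tnth g j) we)) /mmap.
apply: (big_ind reg) => [|? ?|m _]; [exact: r0 | exact: regD |].
apply: (regM); first exact: regC.
apply: (big_ind reg) => [|? ?|i _]; [exact: r1 | exact: regM |].
elim: (m i) => [|n IH]; first by rewrite expr0.
by rewrite exprS; apply: (regM).
Qed.

End Substitution.

Section LocalConditions.
Variable k : fieldType.
Notation E := (frac_field {poly {poly k}}).
Notation iota := (@blow_const k).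
Notation t := (blow_t k).
Notation s := (blow_s k).

Lemma pole_numerator (L : fieldType) (u h b g : L) :
  u != 0 -> (u ^+ 2 * h + b * g) / u ^+ 2 = h + b * g / u ^+ 2.
Proof. by move=> u0; field. Qed.

Lemma addr_cancel (L : zmodType) (x y z : L) : (x + z) - (y + z) = x - y.
Proof. by rewrite opprD addrACA subrr addr0. Qed.

Lemma holo_at_regular p b (F G H : {poly {poly k}}) :
  let v := ev2 iota (iota p + t) ((s + iota b) / t) in
  b != 0 -> regular (v F) -> regular (v G) ->
  regular (v H + iota b * v F / t ^+ 2) -> holo_at p b F G H.
Proof.
move=> v b0 rF rG rH.
split=> //; apply: regular_pole_free => //.
- by rewrite expr0 divr1 ev2_shift.
- by rewrite expr0 divr1 ev2_shift.
rewrite ev2D !ev2Z !ev2_shift ev1Xn ev1C pole_numerator //.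
exact: blow_t_neq0.
Qed.

(** At infinity the regular coordinate is x + c/z, so the residue of x is - c. *)
Lemma holo_at_infinity c (F G H : {poly {poly k}}) :
  let v := ev2 iota ((s + iota (- c)) / t) t in
  c != 0 -> regular (v F + iota (- c) * v H / t ^+ 2) ->
  regular (v G + iota (- c) * v H / t ^+ 2) -> regular (v H) ->
  [/\ pole_free (- c) 0 (swapXY H), pole_free (- c) 0 (swapXY (F - G))
    & pole_free (- c) 2 ('X^2 *: swapXY F + (- c)%:P *: swapXY H)].
Proof.
move=> v c0 rF rG rH; have c'0 : - c != 0 by rewrite oppr_eq0.
split; apply: regular_pole_free => //.
- by rewrite expr0 divr1 ev2_swapXY.
- rewrite expr0 divr1 ev2_swapXY ev2B.
  by have := regularB rF rG; rewrite addr_cancel.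
rewrite ev2D !ev2Z !ev2_swapXY ev1Xn ev1C pole_numerator //.
exact: blow_t_neq0.
Qed.
End LocalConditions.

Section DerivationFormulas.
Variables (L : fieldType) (D : L -> L).
Hypothesis dP : derivation D.

Lemma derivation_add_pole x c z : D c = 0 -> z != 0 ->
  D (x + c / z) = D x - c * D z / z ^+ 2.
Proof.
move=> c0 z0; rewrite (derivationD dP) (derivation_div _ dP z0) c0; field.
exact: z0.
Qed.

Lemma derivation_sub_pole x c z : D c = 0 -> z != 0 ->
  D (x - c / z) = D x + c * D z / z ^+ 2.
Proof.
move=> c0 z0; rewrite (derivationB dP) (derivation_div _ dP z0) c0; field.
exact: z0.
Qed.

Lemma derivation_sub_poles x y c z : D c = 0 -> x != 0 -> y != 0 ->
  D (z - c * (x + y) / (x * y)) = D z + c * D x / x ^+ 2 + c * D y / y ^+ 2.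
Proof.
move=> c0 x0 y0; have xy0 : x * y != 0 by rewrite mulf_neq0.
rewrite (derivationB dP) (derivation_div _ dP xy0) !(derivationM dP) (derivationD dP) c0.
by field; rewrite y0.
Qed.

Lemma derivation_shift x c : D c = 0 -> D (x - c) = D x.
Proof. by move=> c0; rewrite (derivationB dP) c0 subr0. Qed.
End DerivationFormulas.

Lemma forall_ord3 (P : 'I_3 -> Prop) :
  P (inord 0) -> P (inord 1) -> P (inord 2) -> forall j, P j.
Proof.
move=> P0 P1 P2 [[|[|[|//]]] lt_j].
- by rewrite (_ : Ordinal lt_j = inord 0) //; apply: val_inj; rewrite /= inordK.
- by rewrite (_ : Ordinal lt_j = inord 1) //; apply: val_inj; rewrite /= inordK.
- by rewrite (_ : Ordinal lt_j = inord 2) //; apply: val_inj; rewrite /= inordK.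
Qed.

Section Triple.
Variables (T : Type) (a b c : T).
Lemma tnth3_0 : tnth [tuple a; b; c] (inord 0) = a.
Proof. by rewrite (tnth_nth a) inordK. Qed.
Lemma tnth3_1 : tnth [tuple a; b; c] (inord 1) = b.
Proof. by rewrite (tnth_nth a) inordK. Qed.
Lemma tnth3_2 : tnth [tuple a; b; c] (inord 2) = c.
Proof. by rewrite (tnth_nth a) inordK. Qed.
End Triple.

(** * Derivatives of the chart coordinates *)

(** L is the field where the derivation D acts, S a field of functions near one place,
spec the specialization from L to S, and reg the predicate of regularity.  Nothing
else is used of these fields, and abstract fields keep the computation of
derivatives light. *)
Section Transport.
Variables (L S : fieldType) (spec : L -> S -> Prop) (reg : S -> Prop) (D : L -> L).
Hypothesis specD : forall u v e e', spec u e -> spec v e' -> spec (u + v) (e + e').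
Hypothesis specN : forall u e, spec u e -> spec (- u) (- e).
Hypothesis specM : forall u v e e', spec u e -> spec v e' -> spec (u * v) (e * e').
Hypothesis specV : forall u e, e != 0 -> spec u e -> spec u^-1 e^-1.
Hypothesis spec_neq0 : forall u e, e != 0 -> spec u e -> u != 0.
Hypothesis spec1 : spec 1 1.
Hypothesis regD : forall e e', reg e -> reg e' -> reg (e + e').
Hypothesis regN : forall e, reg e -> reg (- e).
Hypothesis regM : forall e e', reg e -> reg e' -> reg (e * e').
Hypothesis dP : derivation D.

Definition holomorphic_in (w : 3.-tuple L) : Prop :=
  forall e : 3.-tuple S, (forall j, spec (tnth w j) (tnth e j)) ->
  (forall j, reg (tnth e j)) -> forall j q, spec (D (tnth w j)) q -> reg q.

Lemma holomorphic_triple w0 w1 w2 e0 e1 e2 q0 q1 q2 :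
  holomorphic_in [tuple w0; w1; w2] ->
  spec w0 e0 -> spec w1 e1 -> spec w2 e2 -> reg e0 -> reg e1 -> reg e2 ->
  spec (D w0) q0 -> spec (D w1) q1 -> spec (D w2) q2 ->
  [/\ reg q0, reg q1 & reg q2].
Proof.
move=> hol s0 s1 s2 r0 r1 r2 d0 d1 d2.
have ws j : spec (tnth [tuple w0; w1; w2] j) (tnth [tuple e0; e1; e2] j).
  by move: j; apply: forall_ord3; rewrite ?tnth3_0 ?tnth3_1 ?tnth3_2.
have rs j : reg (tnth [tuple e0; e1; e2] j).
  by move: j; apply: forall_ord3; rewrite ?tnth3_0 ?tnth3_1 ?tnth3_2.
have R := hol _ ws rs.
split; [apply: (R (inord 0)) | apply: (R (inord 1)) | apply: (R (inord 2))].
- by rewrite tnth3_0.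
- by rewrite tnth3_1.
- by rewrite tnth3_2.
Qed.

Lemma spec_div u v e e' : e' != 0 -> spec u e -> spec v e' -> spec (u / v) (e / e').
Proof. by move=> e'0 su sv; apply: (specM) => //; apply: (specV). Qed.

Lemma spec_sub u v e e' : spec u e -> spec v e' -> spec (u - v) (e - e').
Proof. by move=> su sv; apply: (specD) => //; apply: (specN). Qed.

Lemma spec_sqr u e : spec u e -> spec (u ^+ 2) (e ^+ 2).
Proof. by move=> su; rewrite !expr2; apply: (specM). Qed.

Lemma spec_residue c f u c' f' u' : u' != 0 ->
  spec c c' -> spec f f' -> spec u u' -> spec (c * f / u ^+ 2) (c' * f' / u' ^+ 2).
Proof.
move=> u'0 sc sf su; apply: spec_div; first by rewrite expf_neq0.
  exact: specM.
exact: spec_sqr.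
Qed.

Variables (X Y Z F1 F2 F3 C H : L) (x y z v1 v2 v3 c h : S).
Hypotheses (DX : D X = F1) (DY : D Y = F2) (DZ : D Z = F3).
Hypotheses (DC : D C = 0) (DH : D H = 0).
Hypotheses (sX : spec X x) (sY : spec Y y) (sZ : spec Z z).
Hypotheses (s1 : spec F1 v1) (s2 : spec F2 v2) (s3 : spec F3 v3).
Hypotheses (sC : spec C c) (sH : spec H h).

Lemma pole_in_x u : x - h = u -> u != 0 ->
  holomorphic_in [tuple X - H; Y; Z - C / (X - H)] ->
  reg u -> reg y -> reg (z - c / u) ->
  [/\ reg v1, reg v2 & reg (v3 + c * v1 / u ^+ 2)].
Proof.
move=> <- u0 hol ru ry rz; have su := spec_sub sX sH.
have U0 := spec_neq0 u0 su.
apply: (holomorphic_triple hol su sY _ ru ry rz).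
- by apply: spec_sub => //; apply: spec_div.
- by rewrite (derivation_shift dP) // DX.
- by rewrite DY.
rewrite (derivation_sub_pole dP) // (derivation_shift dP) // DX DZ.
by apply: (specD) => //; apply: spec_residue.
Qed.

Lemma pole_in_y u : y - 1 = u -> u != 0 ->
  holomorphic_in [tuple X; Y - 1; Z - C / (Y - 1)] ->
  reg x -> reg u -> reg (z - c / u) ->
  [/\ reg v1, reg v2 & reg (v3 + c * v2 / u ^+ 2)].
Proof.
move=> <- u0 hol rx ru rz; have su := spec_sub sY spec1.
have U0 := spec_neq0 u0 su; have D1 := derivation1 dP.
apply: (holomorphic_triple hol sX su _ rx ru rz).
- by apply: spec_sub => //; apply: spec_div.
- by rewrite DX.
- by rewrite (derivation_shift dP) // DY.
rewrite (derivation_sub_pole dP) // (derivation_shift dP) // DY DZ.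
by apply: (specD) => //; apply: spec_residue.
Qed.

Lemma pole_at_infinity : z != 0 ->
  holomorphic_in [tuple X + C / Z; Y + C / Z; Z] ->
  reg (x + c / z) -> reg (y + c / z) -> reg z ->
  [/\ reg (v1 - c * v3 / z ^+ 2), reg (v2 - c * v3 / z ^+ 2) & reg v3].
Proof.
move=> z0 hol rx ry rz; have Z0 := spec_neq0 z0 sZ.
have sCZ := spec_div z0 sC sZ.
apply: (holomorphic_triple hol (specD sX sCZ) (specD sY sCZ) sZ rx ry rz).
- rewrite (derivation_add_pole dP) // DX DZ.
  by apply: spec_sub => //; apply: spec_residue.
- rewrite (derivation_add_pole dP) // DY DZ.
  by apply: spec_sub => //; apply: spec_residue.
- by rewrite DZ.
Qed.

Lemma pole_in_xy : x != 0 -> y != 0 ->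
  holomorphic_in [tuple X; Y; Z - C * (X + Y) / (X * Y)] ->
  reg x -> reg y -> reg (z - c / x - c / y) ->
  [/\ reg v1, reg v2 & reg (v3 + c * v1 / x ^+ 2 + c * v2 / y ^+ 2)].
Proof.
move=> x0 y0 hol rx ry rz.
have [X0 Y0] := (spec_neq0 x0 sX, spec_neq0 y0 sY).
have rz' : reg (z - c * (x + y) / (x * y)).
  have -> : z - c * (x + y) / (x * y) = z - c / x - c / y by field; rewrite ?x0 ?y0.
  exact: rz.
apply: (holomorphic_triple hol sX sY _ rx ry rz').
- apply: spec_sub => //; apply: spec_div; first by rewrite mulf_neq0.
    by apply: (specM) => //; apply: (specD).
  exact: specM.
- by rewrite DX.
- by rewrite DY.
rewrite (derivation_sub_poles dP) // DX DY DZ.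
by apply: (specD); [apply: (specD) => // |]; apply: spec_residue.
Qed.

(** The third coordinate has a pole along x = 0 and one along y = 0.  Where x
vanishes y is a unit, so the terms coming from the pole along y = 0 are regular and
can be dropped. *)
Lemma pole_in_xy_x u : x = u -> u != 0 -> y != 0 -> reg c -> reg y^-1 ->
  holomorphic_in [tuple X; Y; Z - C * (X + Y) / (X * Y)] ->
  reg u -> reg y -> reg (z - c / u) ->
  [/\ reg v1, reg v2 & reg (v3 + c * v1 / u ^+ 2)].
Proof.
move=> <- x0 y0 rc rVy hol rx ry rz.
have rcy : reg (- (c / y)) by apply: (regN); apply: (regM).
have [|r1 r2 r3] := pole_in_xy x0 y0 hol rx ry; first exact: regD.
split=> //; have rres : reg (- (c * v2 / y ^+ 2)).
  by rewrite -exprVn expr2; apply: (regN); apply: (regM); apply: (regM).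
by have := regD r3 rres; rewrite addrK.
Qed.

Lemma pole_in_xy_y u : y = u -> x != 0 -> u != 0 -> reg c -> reg x^-1 ->
  holomorphic_in [tuple X; Y; Z - C * (X + Y) / (X * Y)] ->
  reg x -> reg u -> reg (z - c / u) ->
  [/\ reg v1, reg v2 & reg (v3 + c * v2 / u ^+ 2)].
Proof.
move=> <- x0 y0 rc rVx hol rx ry rz.
have rcx : reg (- (c / x)) by apply: (regN); apply: (regM).
have [|r1 r2 r3] := pole_in_xy x0 y0 hol rx ry.
  by rewrite addrAC; apply: regD.
split=> //; have rres : reg (- (c * v1 / x ^+ 2)).
  by rewrite -exprVn expr2; apply: (regN); apply: (regM); apply: (regM).
by have := regD r3 rres; rewrite addrAC addrK.
Qed.

End Transport.

(** * The local conditions given by the four charts *)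
Section CoordinateSystems.
Variable R : realType.
Notation K := (frac_field {poly R[i]}).
Notation k := (frac_field {poly K}).
Notation E := (frac_field {poly {poly k}}).
Notation L := (frac_field (xyz_ring R)).
Notation iota := (@blow_const k).
Notation t := (blow_t k).
Notation s := (blow_s k).
Notation d := (var_d K).

Definition param (c : R[i]) : k := const_d (cst_t c : K).

Definition frac_xyz (p : poly_xyz R) : L := @FracField.tofrac (xyz_ring R) p.
Notation X := (frac_xyz (vx R)).
Notation Y := (frac_xyz (vy R)).
Notation Z := (frac_xyz (vz R)).
Definition frac_cst (c : R[i]) : L := frac_xyz (cst_xyz c).

Lemma coords0E eta b :
  coords0 eta b = [tuple X - frac_cst eta; Y; Z - frac_cst b / (X - frac_cst eta)] :> 3.-tuple L.
Proof. reflexivity. Qed.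

Lemma coords1E b :
  coords1 b = [tuple X; Y - 1; Z - frac_cst b / (Y - 1)] :> 3.-tuple L.
Proof. reflexivity. Qed.

Lemma coords2E b :
  coords2 b = [tuple X + frac_cst b / Z; Y + frac_cst b / Z; Z] :> 3.-tuple L.
Proof. reflexivity. Qed.

Lemma coords3E b :
  coords3 b = [tuple X; Y; Z - frac_cst b * (X + Y) / (X * Y)] :> 3.-tuple L.
Proof. reflexivity. Qed.

Variables f1 f2 f3 : poly_xyz R.
Notation f := [tuple f1; f2; f3].

Definition along_frac : L -> L := total_der f.

Lemma along_frac_x : along_frac X = frac_xyz f1.
Proof. by rewrite /along_frac /frac_xyz [LHS]total_derE alongX tnth3_0. Qed.
Lemma along_frac_y : along_frac Y = frac_xyz f2.
Proof. by rewrite /along_frac /frac_xyz [LHS]total_derE alongX tnth3_1. Qed.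
Lemma along_frac_z : along_frac Z = frac_xyz f3.
Proof. by rewrite /along_frac /frac_xyz [LHS]total_derE alongX tnth3_2. Qed.
Lemma along_frac_cst (c : R[i]) : along_frac (frac_cst c) = 0.
Proof. by rewrite /along_frac /frac_cst /frac_xyz [LHS]total_derE along_cst; apply: rmorph0. Qed.
Lemma along_frac_derivation : derivation along_frac.
Proof. exact: total_der_derivation. Qed.

(** Substitution of x and z by functions near a place, and of y by x - d. *)
Definition spec_at (x z : E) : L -> E -> Prop := specializes (chart_at x z).

Section At.
Variables x z : E.

Lemma spec_x : spec_at x z X x.
Proof. by apply: specializes_tofracE; apply: chart_at_x. Qed.
Lemma spec_y : spec_at x z Y (x - iota d).
Proof. by apply: specializes_tofracE; apply: chart_at_y. Qed.
Lemma spec_z : spec_at x z Z z.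
Proof. by apply: specializes_tofracE; apply: chart_at_z. Qed.
Lemma spec_cst (c : R[i]) : spec_at x z (frac_cst c) (iota (param c)).
Proof. by apply: specializes_tofracE; apply: chart_atC. Qed.
Lemma spec_poly p : spec_at x z (frac_xyz p) (ev2 iota x z (chart_xyz p)).
Proof. by apply: specializes_tofracE. Qed.

Lemma holomorphic_in_chart w :
  polynomial_in f w -> holomorphic_in (spec_at x z) (@regular k) along_frac w.
Proof.
move=> hol e we re; apply: (polynomial_in_closed _ _ _ hol we re).
- by move=> c; apply: chart_at_const.
- exact: regularD.
- exact: regularM.
Qed.
End At.

Notation T := chart_xyz.

Lemma specD x z u v e e' :
  spec_at x z u e -> spec_at x z v e' -> spec_at x z (u + v) (e + e').
Proof. exact: specializesD. Qed.
Lemma specN x z u e : spec_at x z u e -> spec_at x z (- u) (- e).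
Proof. exact: specializesN. Qed.
Lemma specM x z u v e e' :
  spec_at x z u e -> spec_at x z v e' -> spec_at x z (u * v) (e * e').
Proof. exact: specializesM. Qed.
Lemma specV x z u e : e != 0 -> spec_at x z u e -> spec_at x z u^-1 e^-1.
Proof. exact: specializesV. Qed.
Lemma spec_neq0 x z u e : e != 0 -> spec_at x z u e -> u != 0.
Proof. exact: specializes_neq0. Qed.
Lemma spec1 x z : spec_at x z 1 1.
Proof. exact: specializes1. Qed.

Lemma coords0_holo (eta b : R[i]) : param b != 0 ->
  polynomial_in f (coords0 eta b) ->
  holo_at (param eta) (param b) (T f1) (T f2) (T f3).
Proof.
rewrite coords0E => b0 hol; set p := param eta; set c := param b.
pose x : E := iota p + t; pose z : E := (s + iota c) / t.
have t0 := blow_t_neq0 k.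
have xt : x - iota p = t by rewrite /x addrC addKr.
have rx : regular (x - iota d).
  apply: regularB; last exact: regular_const.
  by apply: regularD; [exact: regular_const | exact: regular_t].
have rz : regular (z - iota c / t) by rewrite /z mulrDl addrK; exact: regular_s_t.
have [r1 r2 r3] := pole_in_x (@specD x z) (@specN x z) (@specM x z) (@specV x z)
  (@spec_neq0 x z) along_frac_derivation
  along_frac_x along_frac_y along_frac_z (along_frac_cst b) (along_frac_cst eta)
  (spec_x x z) (spec_y x z) (spec_z x z) (spec_poly x z f1) (spec_poly x z f2)
  (spec_poly x z f3) (spec_cst x z b) (spec_cst x z eta) xt t0
  (holomorphic_in_chart hol) (regular_t k) rx rz.
exact (@holo_at_regular k p c (T f1) (T f2) (T f3) b0 r1 r2 r3).
Qed.

Lemma var_d_neq0 : d != 0.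
Proof. by rewrite /var_d [_ == 0]tofrac_eq0 polyX_eq0. Qed.

Lemma regular_shifted_z (c : k) : regular ((s + iota c) / t - iota c / t).
Proof. by rewrite mulrDl addrK; exact: regular_s_t. Qed.

Lemma addr_unshift (S : comPzRingType) (a b c : S) : a + b + c - a - b = c.
Proof. by ring. Qed.

Lemma coords1_holo (b : R[i]) : param b != 0 ->
  polynomial_in f (coords1 b) ->
  holo_at (d + 1) (param b) (T f2) (T f1) (T f3).
Proof.
rewrite coords1E => b0 hol; set p := d + 1; set c := param b.
pose x : E := iota p + t; pose z : E := (s + iota c) / t.
have t0 := blow_t_neq0 k.
have pE : iota p = iota d + 1 by rewrite /p rmorphD rmorph1.
have yt : x - iota d - 1 = t by rewrite /x pE; exact: addr_unshift.
have rx : regular x.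
  by apply: regularD; [exact: regular_const | exact: regular_t].
have [r1 r2 r3] := pole_in_y (@specD x z) (@specN x z) (@specM x z) (@specV x z)
  (@spec_neq0 x z) (@spec1 x z) along_frac_derivation
  along_frac_x along_frac_y along_frac_z (along_frac_cst b)
  (spec_x x z) (spec_y x z) (spec_z x z) (spec_poly x z f1) (spec_poly x z f2)
  (spec_poly x z f3) (spec_cst x z b) yt t0
  (holomorphic_in_chart hol) rx (regular_t k) (regular_shifted_z c).
exact (@holo_at_regular k p c (T f2) (T f1) (T f3) b0 r2 r1 r3).
Qed.

Lemma coords3_holo_x (b : R[i]) : param b != 0 ->
  polynomial_in f (coords3 b) ->
  holo_at 0 (param b) (T f1) (T f2) (T f3).
Proof.
rewrite coords3E => b0 hol; set c := param b.
pose x : E := iota 0 + t; pose z : E := (s + iota c) / t.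
have t0 := blow_t_neq0 k.
have xt : x = t by rewrite /x rmorph0 add0r.
have yE : x - iota d = ev1 iota t ('X - d%:P) by rewrite xt rmorphB /= ev1X ev1C.
have m0 : ('X - d%:P).[0] != 0 by rewrite hornerXsubC sub0r oppr_eq0 var_d_neq0.
have y0 : x - iota d != 0 by rewrite yE ev1_blow_t_neq0.
have rVy : regular (x - iota d)^-1 by rewrite yE; apply: regularV.
have ry : regular (x - iota d).
  by rewrite xt; apply: regularB; [exact: regular_t | exact: regular_const].
have [r1 r2 r3] := pole_in_xy_x (@specD x z) (@specN x z) (@specM x z) (@specV x z)
  (@spec_neq0 x z) (@regularD k) (@regularN k) (@regularM k) along_frac_derivation
  along_frac_x along_frac_y along_frac_z (along_frac_cst b)
  (spec_x x z) (spec_y x z) (spec_z x z) (spec_poly x z f1) (spec_poly x z f2)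
  (spec_poly x z f3) (spec_cst x z b) xt t0 y0 (regular_const c) rVy
  (holomorphic_in_chart hol) (regular_t k) ry (regular_shifted_z c).
exact (@holo_at_regular k 0 c (T f1) (T f2) (T f3) b0 r1 r2 r3).
Qed.

Lemma coords3_holo_y (b : R[i]) : param b != 0 ->
  polynomial_in f (coords3 b) ->
  holo_at d (param b) (T f2) (T f1) (T f3).
Proof.
rewrite coords3E => b0 hol; set c := param b.
pose x : E := iota d + t; pose z : E := (s + iota c) / t.
have t0 := blow_t_neq0 k.
have yt : x - iota d = t by rewrite /x addrC addKr.
have xE : x = ev1 iota t (d%:P + 'X) by rewrite rmorphD /= ev1X ev1C.
have m0 : (d%:P + 'X).[0] != 0 by rewrite hornerD hornerX hornerC addr0 var_d_neq0.
have x0 : x != 0 by rewrite xE ev1_blow_t_neq0.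
have rVx : regular x^-1 by rewrite xE; apply: regularV.
have rx : regular x.
  by apply: regularD; [exact: regular_const | exact: regular_t].
have [r1 r2 r3] := pole_in_xy_y (@specD x z) (@specN x z) (@specM x z) (@specV x z)
  (@spec_neq0 x z) (@regularD k) (@regularN k) (@regularM k) along_frac_derivation
  along_frac_x along_frac_y along_frac_z (along_frac_cst b)
  (spec_x x z) (spec_y x z) (spec_z x z) (spec_poly x z f1) (spec_poly x z f2)
  (spec_poly x z f3) (spec_cst x z b) yt x0 t0 (regular_const c) rVx
  (holomorphic_in_chart hol) rx (regular_t k) (regular_shifted_z c).
exact (@holo_at_regular k d c (T f2) (T f1) (T f3) b0 r2 r1 r3).
Qed.

Lemma opp_residue (S : fieldType) (a b u v : S) :
  a - b * v / u ^+ 2 = a + (- b) * v / u ^+ 2.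
Proof. by rewrite !mulNr. Qed.

Lemma coords2_holo (b : R[i]) : param b != 0 ->
  polynomial_in f (coords2 b) ->
  [/\ pole_free (- param b) 0 (swapXY (T f3)),
      pole_free (- param b) 0 (swapXY (T f1 - T f2))
    & pole_free (- param b) 2
        ('X^2 *: swapXY (T f1) + (- param b)%:P *: swapXY (T f3))].
Proof.
rewrite coords2E => b0 hol; set c := param b.
pose x : E := (s + iota (- c)) / t.
have t0 := blow_t_neq0 k.
have icN : iota (- c) = - iota c by exact: rmorphN.
have xE : x + iota c / t = s / t by rewrite /x icN mulrDl mulNr subrK.
have rx : regular (x + iota c / t) by rewrite xE; exact: regular_s_t.
have ry : regular (x - iota d + iota c / t).
  rewrite addrAC xE; apply: regularB; [exact: regular_s_t | exact: regular_const].
have [r1 r2 r3] := pole_at_infinity (@specD x t) (@specN x t) (@specM x t) (@specV x t)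
  (@spec_neq0 x t) along_frac_derivation along_frac_x along_frac_y along_frac_z (along_frac_cst b)
  (spec_x x t) (spec_y x t) (spec_z x t) (spec_poly x t f1) (spec_poly x t f2)
  (spec_poly x t f3) (spec_cst x t b) t0
  (holomorphic_in_chart hol) rx ry (regular_t k).
have r1' := r1; rewrite opp_residue -icN in r1'.
have r2' := r2; rewrite opp_residue -icN in r2'.
exact (@holo_at_infinity k c (T f1) (T f2) (T f3) b0 r1' r2' r3).
Qed.

End CoordinateSystems.

(** * Injectivity of the coordinate change and total degree *)
Section ChartDegree.
Variable K : fieldType.
Notation k := (frac_field {poly K}).

Lemma mpoly_rmorph_ext n (S : comNzRingType) (f g : {rmorphism {mpoly K[n]} -> S}) :
  (forall c, f c%:MP = g c%:MP) -> (forall i, f 'X_i = g 'X_i) -> f =1 g.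
Proof.
move=> fgC fgX; elim/mpolyind => [|c m p _ _ IH]; first by rewrite !rmorph0.
rewrite !rmorphD /= IH; congr (_ + _); rewrite -mul_mpolyC !rmorphM /= fgC; congr (_ * _).
by rewrite mpolyXE_id !rmorph_prod /=; apply: eq_bigr => i _; rewrite !rmorphXn /= fgX.
Qed.

Definition chart0_const : K -> {poly {poly {poly K}}} := polyC \o polyC \o polyC.
HB.instance Definition _ :=
  GRing.RMorphism.copy chart0_const (polyC \o polyC \o polyC).

Definition chart0_coords : 3.-tuple {poly {poly {poly K}}} :=
  [tuple 'X%:P; ('X - 'X%:P)%:P; 'X].

(** [chart] before the scalars are extended from K[d] to K(d): it is an isomorphism
onto K[d][x][z], and it shows that coefficients are polynomials in d and how
their degrees are bounded. *)
Definition chart0 : {mpoly K[3]} -> {poly {poly {poly K}}} :=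
  mmap chart0_const (tnth chart0_coords).
HB.instance Definition _ :=
  GRing.RMorphism.copy chart0 (mmap chart0_const (tnth chart0_coords)).

Definition frac_coefs : {poly {poly {poly K}}} -> {poly {poly k}} :=
  map_poly (map_poly (@FracField.tofrac {poly K})).
HB.instance Definition _ :=
  GRing.RMorphism.copy frac_coefs (map_poly (map_poly (@FracField.tofrac {poly K}))).

Lemma chart0E p : chart p = frac_coefs (chart0 p).
Proof.
have := @mpoly_rmorph_ext 3 _ (@chart K) (frac_coefs \o chart0); apply=> [c|] /=.
  by rewrite chartC /chart0 mmapC /frac_coefs /chart0_const /= !map_polyC /= map_polyC.
apply: forall_ord3; rewrite ?chart_x ?chart_y ?chart_z /chart0 /= mmapX mmap1U.
- by rewrite tnth3_0 /frac_coefs map_polyC /= map_polyX.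
- by rewrite tnth3_1 /frac_coefs map_polyC /= [map_poly _ ('X - _)]rmorphB /= map_polyX map_polyC.
- by rewrite tnth3_2 /frac_coefs map_polyX.
Qed.

Definition unchart_d : {poly K} -> {mpoly K[3]} :=
  horner_eval ('X_(inord 0) - 'X_(inord 1)) \o map_poly (@mpolyC 3 K).
HB.instance Definition _ := GRing.RMorphism.copy unchart_d
  (horner_eval ('X_(inord 0) - 'X_(inord 1)) \o map_poly (@mpolyC 3 K)).
Definition unchart_x : {poly {poly K}} -> {mpoly K[3]} :=
  horner_eval 'X_(inord 0) \o map_poly unchart_d.
HB.instance Definition _ := GRing.RMorphism.copy unchart_x
  (horner_eval 'X_(inord 0) \o map_poly unchart_d).
Definition unchart : {poly {poly {poly K}}} -> {mpoly K[3]} :=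
  horner_eval 'X_(inord 2) \o map_poly unchart_x.
HB.instance Definition _ := GRing.RMorphism.copy unchart
  (horner_eval 'X_(inord 2) \o map_poly unchart_x).

Let unchart_dC c : unchart_d c%:P = c%:MP.
Proof. by rewrite /unchart_d /= /horner_eval map_polyC hornerC. Qed.
Let unchart_dX : unchart_d 'X = 'X_(inord 0) - 'X_(inord 1).
Proof. by rewrite /unchart_d /= /horner_eval map_polyX hornerX. Qed.
Let unchart_xC c : unchart_x c%:P = unchart_d c.
Proof. by rewrite /unchart_x /= /horner_eval map_polyC hornerC. Qed.
Let unchart_xX : unchart_x 'X = 'X_(inord 0).
Proof. by rewrite /unchart_x /= /horner_eval map_polyX hornerX. Qed.
Let unchartC c : unchart c%:P = unchart_x c.
Proof. by rewrite /unchart /= /horner_eval map_polyC hornerC. Qed.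
Let unchartX : unchart 'X = 'X_(inord 2).
Proof. by rewrite /unchart /= /horner_eval map_polyX hornerX. Qed.

Lemma chart0K : cancel chart0 unchart.
Proof.
have := @mpoly_rmorph_ext 3 {mpoly K[3]} (unchart \o chart0) idfun; apply=> [c|] /=.
  by rewrite /chart0 mmapC unchartC unchart_xC unchart_dC.
apply: forall_ord3; rewrite /chart0 /= mmapX mmap1U ?tnth3_0 ?tnth3_1 ?tnth3_2.
- by rewrite unchartC unchart_xX.
- by rewrite unchartC rmorphB /= unchart_xX unchart_xC unchart_dX opprB addrC subrK.
- exact: unchartX.
Qed.

Lemma tofrac_inj (A : idomainType) : injective (@FracField.tofrac A).
Proof. by move=> p q /eqP; rewrite tofrac_eq => /eqP. Qed.

Lemma chart_inj : injective (@chart K).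
Proof.
move=> p q; rewrite !chart0E => pq; apply: (can_inj chart0K).
apply: map_inj_poly pq; last by rewrite map_poly0.
by apply: map_inj_poly; [exact: tofrac_inj | exact: rmorph0].
Qed.

(** Total degree less than n in d, x and z together. *)
Definition tdegree_le n (P : {poly {poly {poly K}}}) : Prop :=
  forall l i, (size ((P`_l)`_i)%R <= n - l - i)%N.

Lemma tdegree_leD n P Q : tdegree_le n P -> tdegree_le n Q -> tdegree_le n (P + Q).
Proof.
move=> dP dQ l i; rewrite !coefD (leq_trans (size_polyD _ _)) // geq_max.
by rewrite dP dQ.
Qed.

Lemma tdegree_leN n P : tdegree_le n P -> tdegree_le n (- P).
Proof. by move=> dP l i; rewrite !coefN size_polyN. Qed.

Lemma tdegree_le_leq n m P : (n <= m)%N -> tdegree_le n P -> tdegree_le m P.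
Proof. by move=> le_nm dP l i; rewrite (leq_trans (dP l i)) // !leq_sub2r. Qed.

Lemma tdegree_le_const c : tdegree_le 1 (chart0_const c).
Proof.
move=> [|l] i; rewrite coefC /=; last by rewrite coef0 size_poly0.
case: i => [|i]; rewrite coefC /=; last by rewrite size_poly0.
exact: size_polyC_leq1.
Qed.

Lemma tdegree_le_mulz n P : tdegree_le n P -> tdegree_le n.+1 (P * 'X).
Proof.
move=> dP [|l] i; rewrite coefMX /=; first by rewrite coef0 size_poly0.
exact: dP.
Qed.

Lemma tdegree_le_mulx n P : tdegree_le n P -> tdegree_le n.+1 (P * 'X%:P).
Proof.
move=> dP l [|i]; rewrite coefMC coefMX /=; first by rewrite size_poly0.
by rewrite (leq_trans (dP l i)) //; lia.
Qed.

Lemma tdegree_le_muld n P : tdegree_le n P -> tdegree_le n.+1 (P * 'X%:P%:P).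
Proof.
move=> dP l i; rewrite !coefMC.
have [->|nz] := eqVneq ((P`_l)`_i) 0; first by rewrite mul0r size_poly0.
rewrite size_mulX //; have := dP l i.
have : (0 < size ((P`_l)`_i)%R)%N by rewrite size_poly_gt0.
lia.
Qed.

Lemma tdegree_le_coords n P i :
  tdegree_le n P -> tdegree_le n.+1 (P * tnth chart0_coords i).
Proof.
move=> dP; move: i; apply: forall_ord3; rewrite ?tnth3_0 ?tnth3_1 ?tnth3_2.
- exact: tdegree_le_mulx.
- rewrite polyCB mulrBr; apply: tdegree_leD; first exact: tdegree_le_mulx.
  by apply: tdegree_leN; apply: tdegree_le_muld.
- exact: tdegree_le_mulz.
Qed.

Lemma tdegree_chart0 p : tdegree_le (msize p) (chart0 p).
Proof.
rewrite /chart0 /mmap big_seq; apply: (big_ind (tdegree_le (msize p))).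
- by move=> l i; rewrite !coef0 size_poly0.
- exact: tdegree_leD.
move=> m m_supp; apply: (@tdegree_le_leq (mdeg m).+1); first exact: msize_mdeg_lt.
rewrite /mmap1 mdegE.
have step (s : seq 'I_3) n P : tdegree_le n P ->
    tdegree_le (n + \sum_(i <- s) m i) (P * \prod_(i <- s) tnth chart0_coords i ^+ m i).
  elim: s n P => [|i s IH] n P dP; first by rewrite !big_nil addn0 mulr1.
  rewrite !big_cons mulrA addnA; apply: IH.
  elim: (m i) => [|a IHa]; first by rewrite addn0 expr0 mulr1.
  by rewrite exprSr mulrA addnS; apply: tdegree_le_coords.
by have := step (index_enum 'I_3) 1 _ (tdegree_le_const p@_m); rewrite add1n.
Qed.

Definition frac_d : {poly K} -> k := @FracField.tofrac {poly K}.
HB.instance Definition _ := GRing.RMorphism.copy frac_d (@FracField.tofrac {poly K}).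

Lemma frac_d_inj : injective frac_d. Proof. exact: tofrac_inj. Qed.

Lemma coef_chart (p : {mpoly K[3]}) l i :
  ((chart p)`_l)`_i = frac_d ((chart0 p)`_l)`_i.
Proof. by rewrite chart0E /frac_coefs !coef_map. Qed.

Lemma size_chart (p : {mpoly K[3]}) l : (size ((chart p)`_l)%R <= msize p - l)%N.
Proof.
apply/leq_sizeP => i le_i; rewrite coef_chart.
have /size_poly_leq0P -> : (size (((chart0 p)`_l)`_i)%R <= 0)%N.
  by rewrite (leq_trans (tdegree_chart0 p l i)) // leqn0 subn_eq0.
exact: rmorph0.
Qed.

Lemma chartZ a p : chart (a *: p) = (const_d a)%:P%:P * chart p :> {poly {poly k}}.
Proof. by rewrite -mul_mpolyC (rmorphM (@chart K)) /= chartC. Qed.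

Lemma chartN p : chart (- p) = - chart p :> {poly {poly k}}.
Proof. exact: rmorphN. Qed.

Lemma chartZN a p : chart (- a *: p) = - ((const_d a)%:P%:P * chart p) :> {poly {poly k}}.
Proof. by rewrite (_ : - a *: p = - (a *: p)) ?chartN ?chartZ //; apply: scaleNr. Qed.

End ChartDegree.

(** * The factor depending on d *)
Section SlopeDivision.
Variables (K : fieldType) (e : K).
Hypothesis two_neq0 : 2 != 0 :> K.
Hypotheses (e_neq1 : e != 1) (e_neqN1 : e != -1).

(** At the root r = (e - 1)/2 of the slope, the defect is the square of (e^2 - 1)/4,
so l must vanish at r; being of degree at most 1, it is a constant multiple of the
slope. *)
Lemma slope_divides (l v : {poly K}) : (size l <= 2)%N ->
  l * D4defect 'X e%:P = - (2 * D4slope 'X e%:P * v) ->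
  exists c, l = c%:P * D4slope 'X e%:P.
Proof.
move=> szl rel; pose r := (e - 1) / 2.
have slope_r : D4slope r e = 0 by rewrite /D4slope /r; field.
have defect_r : D4defect r e != 0.
  have -> : D4defect r e = ((e - 1) / 2 * ((e + 1) / 2)) ^+ 2.
    by rewrite /D4defect /r; field.
  rewrite expf_neq0 // !mulf_neq0 ?invr_eq0 ?subr_eq0 //.
  by rewrite -[1]opprK subr_eq0.
have root_r : l.[r] = 0.
  apply: (mulIf defect_r); rewrite mul0r.
  have defectE : (D4defect 'X e%:P).[r] = D4defect r e.
    by rewrite /D4defect !(hornerM, hornerD, hornerN, hornerX, hornerC).
  have slopeE : (D4slope 'X e%:P).[r] = D4slope r e.
    by rewrite /D4slope -polyC_natr !(hornerM, hornerD, hornerN, hornerX, hornerC).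
  by rewrite -defectE -hornerM rel hornerN mulrAC hornerM slopeE slope_r mulr0 oppr0.
exists (l`_1 / 2).
have l0 : l`_0 = - (l`_1 * r).
  move: root_r; rewrite (horner_coef_wide _ szl) !big_ord_recl big_ord0 /=.
  by rewrite /bump /= expr0 expr1 mulr1 addr0 => /eqP; rewrite addr_eq0 => /eqP.
apply/polyP => -[|[|j]]; rewrite coefCM /D4slope coefB coefD.
all: rewrite -polyC_natr coefCM coefX coef1 coefC /=.
- by rewrite l0 /r; field.
- by field.
by rewrite nth_default ?(leq_trans szl) // !mulr0 addr0 subr0 mulr0.
Qed.

Lemma slope_poly_neq0 : D4slope 'X e%:P != 0 :> {poly K}.
Proof.
apply: contraNneq two_neq0 => /(congr1 (fun p : {poly K} => p`_1)).
rewrite /D4slope coefB coefD -polyC_natr coefCM coefX coef1 coefC coef0 /=.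
by rewrite mulr1 addr0 subr0 => ->.
Qed.
End SlopeDivision.

Lemma uniq_of_neq (T : eqType) (a b c d : T) :
  a != b -> a != c -> a != d -> b != c -> b != d -> c != d -> uniq [:: a; b; c; d].
Proof. by move=> ab ac ad bc bd cd; rewrite /= !inE !negb_or ab ac ad bc bd cd. Qed.

Lemma two_neq0_bipoly (F : fieldType) : 2 != 0 :> F -> 2 != 0 :> {poly {poly F}}.
Proof.
move=> two0; have -> : 2 = (2 : F)%:P%:P :> {poly {poly F}} by rewrite !polyC_natr.
by rewrite !polyC_eq0.
Qed.

(** * Uniqueness up to a factor depending on t *)
Section Uniqueness.
Variable K : fieldType.
Notation k := (frac_field {poly K}).
Notation cst := (@const_d K).
Notation d := (var_d K).
Variables eta b0 b1 b2 b3 : K.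
Hypothesis two_neq0 : 2 != 0 :> K.
Hypothesis sum_b : b0 + b1 + 2 * b2 + 2 * b3 = 1.
Hypotheses (eta_neq0 : eta != 0) (eta_neq1 : eta != 1) (eta_neqN1 : eta != -1).
Hypothesis b2_neq0 : b2 != 0.
Variables f1 f2 f3 : {mpoly K[3]}.
Hypothesis f1_neq0 : f1 != 0.
Hypotheses (deg_f1 : (msize f1 <= 7)%N) (deg_f2 : (msize f2 <= 7)%N).
Hypothesis deg_f3 : (msize f3 <= 7)%N.
Notation F := (chart f1).
Notation E := (chart f2).
Notation H := (chart f3).
Hypothesis at_0 : holo_at 0 (cst b3) F E H.
Hypothesis at_eta : holo_at (cst eta) (cst b0) F E H.
Hypothesis at_d : holo_at d (cst b3) E F H.
Hypothesis at_d1 : holo_at (d + 1) (cst b1) E F H.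
Hypothesis H_inf : pole_free (- cst b2) 0 (swapXY H).
Hypothesis D_inf : pole_free (- cst b2) 0 (swapXY (F - E)).
Hypothesis F_inf :
  pole_free (- cst b2) 2 ('X^2 *: swapXY F + (- cst b2)%:P *: swapXY H).

Let cst_eq0 a : (cst a == 0) = (a == 0).
Proof. exact: fmorph_eq0. Qed.

Let cst2 : 2 != 0 :> k.
Proof. by rewrite -(rmorph_nat cst) cst_eq0. Qed.

Let sum_cst : cst b0 + cst b1 + 2 * cst b2 + 2 * cst b3 = 1.
Proof.
have E1 : cst (b0 + b1 + 2 * b2 + 2 * b3) = 1 by rewrite sum_b rmorph1.
by rewrite -[RHS]E1 !(rmorphD cst, rmorphM cst, rmorph_nat cst).
Qed.

Let var_d_neq_cst a : d != cst a.
Proof.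
rewrite /var_d [_ == _](tofrac_eq 'X a%:P); apply: contraNneq (oner_neq0 K).
by move/(congr1 (fun p : {poly K} => p`_1)); rewrite coefX coefC => /eqP.
Qed.

Let points_uniq : uniq [:: 0; cst eta; d; d + 1].
Proof.
have n0 : d != 0 by rewrite -(rmorph0 cst) var_d_neq_cst.
have ne : d != cst eta by exact: var_d_neq_cst.
have n1 : d + 1 != 0.
  by rewrite addr_eq0 -(rmorph1 cst) -(rmorphN cst) var_d_neq_cst.
have ne1 : d + 1 != cst eta.
  by rewrite eq_sym -subr_eq eq_sym -(rmorph1 cst) -(rmorphB cst) var_d_neq_cst.
have nd : d != d + 1.
  by rewrite -subr_eq0 opprD addrA subrr sub0r oppr_eq0 oner_eq0.
have neta : cst eta != 0 by rewrite cst_eq0.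
have n0' := n0; rewrite eq_sym in n0'.
have n1' := n1; rewrite eq_sym in n1'.
have ne' := ne; rewrite eq_sym in ne'.
have ne1' := ne1; rewrite eq_sym in ne1'.
have neta' := neta; rewrite eq_sym in neta'.
exact: (uniq_of_neq neta' n0' n1' ne' ne1' nd).
Qed.

(** Here c is the quotient of L by 2d + 1 - eta, an element of K, and the factor
- 2/c brings L to the value - 2 (2d + 1 - eta) that it has in the D4 system. *)
Lemma system_unique : exists2 c, c != 0 &
  let kappa := - 2 / c in
  [/\ kappa *: f1 = D4P 'X_(inord 0) 'X_(inord 1) 'X_(inord 2)
        eta%:MP b0%:MP b3%:MP b2%:MP b1%:MP b3%:MP,
      - kappa *: f2 = D4Q 'X_(inord 0) 'X_(inord 1) 'X_(inord 2)
        eta%:MP b0%:MP b3%:MP b2%:MP b1%:MP b3%:MP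
    & kappa *: f3 = D4R 'X_(inord 0) 'X_(inord 1) 'X_(inord 2)
        eta%:MP b0%:MP b3%:MP b2%:MP b1%:MP b3%:MP].
Proof.
have deg (p : {mpoly K[3]}) l : (msize p <= 7)%N -> (size ((chart p)`_l)%R <= 7 - l)%N.
  by move=> szp; rewrite (leq_trans (size_chart p l)) // leq_sub2r.
have b2c : cst b2 != 0 by rewrite cst_eq0.
have [A [FE EE HE [szA leadA] [A0 Aeta Ad Ad1]]] := classification cst2 b2c points_uniq
  (fun l => deg f1 l deg_f1) (fun l => deg f2 l deg_f2) (fun l => deg f3 l deg_f3)
  at_0 at_eta at_d at_d1 H_inf D_inf F_inf.
move: FE EE HE leadA A0 Aeta Ad Ad1; rewrite /leading /defect.
pose lp := ((chart0 f1)`_1)`_4; pose up := ((chart0 (f1 - f2))`_0)`_0.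
have -> : (F`_1)`_4 = frac_d lp by exact: coef_chart.
have -> : ((F - E)`_0)`_0 = frac_d up.
  have <- : chart (f1 - f2) = F - E by exact: rmorphB.
  exact: coef_chart.
move=> FE EE HE leadA A0 Aeta Ad Ad1.
have relk := lagrange_relation sum_cst points_uniq szA leadA A0 Aeta Ad Ad1.
pose N : {poly K} := D4defect 'X eta%:P; pose S : {poly K} := D4slope 'X eta%:P.
have defectE : frac_d N = D4defect d (cst eta) by exact: (rmorph_D4defect (@frac_d K)).
have slopeE : frac_d S = D4slope d (cst eta) by exact: (rmorph_D4slope (@frac_d K)).
have relp : lp * N = - (2 * S * up).
  apply: frac_d_inj.
  rewrite (rmorphM (@frac_d K) lp) (rmorphN (@frac_d K)) (rmorphM (@frac_d K) _ up).
  by rewrite (rmorphM (@frac_d K) 2) (rmorph_nat (@frac_d K)) /= defectE slopeE.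
(* x^4 z uses up five of the six degrees, which leaves degree at most 1 in d. *)
have szlp : (size lp <= 2)%N.
  by rewrite (leq_trans (tdegree_chart0 f1 1 4)) // -subnDA leq_subLR.
have [c lpE] := slope_divides two_neq0 eta_neq1 eta_neqN1 szlp relp.
have S0 : D4slope d (cst eta) != 0.
  by rewrite -slopeE (inj_eq (@frac_d_inj K) _ 0); apply: slope_poly_neq0.
have LE : frac_d lp = cst c * D4slope d (cst eta) :> k.
  by rewrite -slopeE lpE; exact: (rmorphM (@frac_d K)).
move: FE EE HE leadA A0 Aeta Ad Ad1 relk; rewrite LE.
set u : k := frac_d up; move=> FE EE HE leadA A0 Aeta Ad Ad1 relk.
have c0 : c != 0.
  apply: contraNneq f1_neq0 => c0; apply/eqP; apply: (@chart_inj K).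
  rewrite [RHS](rmorph0 (@chart K)).
  have L0 : cst c * D4slope d (cst eta) = 0 by rewrite c0 (rmorph0 cst) mul0r.
  rewrite FE (degenerate_solution sum_cst cst2 points_uniq szA leadA A0 Aeta Ad Ad1 S0 L0).
  by rewrite L0 scale0r polyC0 mul0r addr0.
exists c => //; set kappa := - 2 / c.
have kc : cst kappa * cst c = - 2.
  by rewrite -(rmorphM cst) /kappa divfK // (rmorphN cst) (rmorph_nat cst).
have cc0 : cst c != 0 by rewrite cst_eq0.
have [kL ku] := scaling_factor sum_cst points_uniq szA leadA A0 Aeta Ad Ad1 S0 cc0 (erefl _) kc.
pose lift : {rmorphism {poly k} -> {poly {poly k}}} := @polyC {poly k}.
have EF := scaled_F sum_cst cst2 points_uniq szA A0 Aeta Ad Ad1 kL ku lift 'X.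
have EE' := scaled_E sum_cst cst2 points_uniq szA A0 Aeta Ad Ad1 kL ku lift 'X.
have EH := @scaled_H k _ _ _ _ _ _ sum_cst cst2 points_uniq _ _ _ szA A0 Aeta Ad Ad1
  _ kL ku _ lift 'X H.
have xE : chart 'X_(inord 0) = lift 'X :> {poly {poly k}} := chart_x K.
have yE : chart 'X_(inord 1) = lift 'X - lift d%:P := etrans (chart_y K) (polyCB _ _).
have zE : chart 'X_(inord 2) = 'X :> {poly {poly k}} := chart_z K.
pose C a : chart a%:MP = lift (cst a)%:P := chartC a.
have PE := rmorph_D4P xE yE zE (C eta) (C b0) (C b3) (C b2) (C b1) (C b3).
have QE := rmorph_D4Q xE yE zE (C eta) (C b0) (C b3) (C b2) (C b1) (C b3).
have RE := rmorph_D4R xE yE zE (C eta) (C b0) (C b3) (C b2) (C b1) (C b3).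
split; apply: (@chart_inj K).
- apply: etrans (chartZ kappa f1) (etrans _ (esym PE)).
  by rewrite -EF FE.
- apply: etrans (chartZN kappa f2) (etrans _ (esym QE)).
  by rewrite -EE' EE FE.
apply: etrans (chartZ kappa f3) (etrans _ (esym RE)).
apply: (mulfI (two_neq0_bipoly cst2)); apply: EH.
exact: etrans (mulr_natl H 2) HE.
Qed.
End Uniqueness.

Lemma time_scale (K : fieldType) (e c : K) :
  e != 0 -> c != 0 -> 2 * e / - (e * c) = - 2 / c.
Proof. by move=> e0 c0; field; rewrite c0 oppr_eq0 mulf_neq0. Qed.

Lemma time_scale_neq0 (K : fieldType) (e c : K) :
  e != 0 -> c != 0 -> - (e * c) != 0.
Proof. by move=> e0 c0; rewrite oppr_eq0 mulf_neq0. Qed.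

Lemma parameter_sum (A : comPzRingType) (b0 b1 b2 b3 : A) :
  b0 + b3 + 2 * b2 + b1 + b3 = b0 + b1 + 2 * b2 + 2 * b3.
Proof. by ring. Qed.

Section Constants.
Variable R : realType.
Notation K := (frac_field {poly R[i]}).

Definition cst_K : R[i] -> K := (@FracField.tofrac _) \o polyC.
HB.instance Definition _ :=
  GRing.RMorphism.copy cst_K ((@FracField.tofrac _) \o polyC).

Lemma cst_K_eq0 a : (cst_K a == 0) = (a == 0).
Proof. exact: fmorph_eq0. Qed.

Lemma cst_K_inj : injective cst_K.
Proof. exact: fmorph_inj. Qed.

Lemma two_neq0_K : 2 != 0 :> K.
Proof. by rewrite -(rmorph_nat cst_K) cst_K_eq0 Num.Theory.pnatr_eq0. Qed.

Lemma param_neq0 (a : R[i]) : a != 0 -> param a != 0.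
Proof.
move=> a0; rewrite (fmorph_eq0 (@const_d K)); rewrite -cst_K_eq0 in a0; exact: a0.
Qed.
End Constants.

Theorem theorem4p1 (R : realType) (eta b0 b1 b2 b3 : R[i])
    (f1 f2 f3 : poly_xyz R)
    (eta_neq0 : eta != 0)
    (sum_b : b0 + b1 + 2 * b2 + 2 * b3 = 1)
    (* genericity *)
    (eta_neq1 : eta != 1) (eta_neqN1 : eta != -1)
    (b0_neq0 : b0 != 0) (b1_neq0 : b1 != 0)
    (b2_neq0 : b2 != 0) (b3_neq0 : b3 != 0)
    (* (A1): msize is the total degree plus one *)
    (deg_f1 : msize f1 = 7%N) (deg_f2 : msize f2 = 7%N) (deg_f3 : msize f3 = 7%N)
    (* (A2) *)
    (hol0 : polynomial_in [tuple f1; f2; f3] (coords0 eta b0))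
    (hol1 : polynomial_in [tuple f1; f2; f3] (coords1 b1))
    (hol2 : polynomial_in [tuple f1; f2; f3] (coords2 b2))
    (hol3 : polynomial_in [tuple f1; f2; f3] (coords3 b3)) :
  exists (b : ratfun_t R) (a0 a1 a2 a3 a4 : R[i]),
    [/\ b != 0,
        a0 + a1 + 2 * a2 + a3 + a4 = 1,
        [/\ a4 = a1, b0 = a0, b1 = a3, b2 = a2 & b3 = a1]
      & D4_system eta b a0 a1 a2 a3 a4 [tuple f1; f2; f3]].
Proof.
pose K : fieldType := frac_field {poly R[i]}.
have [inf1 inf2 inf3] := coords2_holo (param_neq0 b2_neq0) hol2.
have at0 := coords3_holo_x (param_neq0 b3_neq0) hol3.
have ateta := coords0_holo (param_neq0 b0_neq0) hol0.
have atd := coords3_holo_y (param_neq0 b3_neq0) hol3.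
have atd1 := coords1_holo (param_neq0 b1_neq0) hol1.
have sumK : cst_K b0 + cst_K b1 + 2 * cst_K b2 + 2 * cst_K b3 = 1.
  have E1 : cst_K (b0 + b1 + 2 * b2 + 2 * b3) = 1 by rewrite sum_b rmorph1.
  rewrite -[RHS]E1 !(rmorphD (@cst_K R), rmorphM (@cst_K R), rmorph_nat (@cst_K R)).
  reflexivity.
have e0 : cst_K eta != 0 by rewrite cst_K_eq0.
have e1 : cst_K eta != 1.
  by rewrite -(rmorph1 (@cst_K R)) (inj_eq (@cst_K_inj R)).
have eN1 : cst_K eta != -1.
  by rewrite -(rmorphN1 (@cst_K R)) (inj_eq (@cst_K_inj R)).
have b20 : cst_K b2 != 0 by rewrite cst_K_eq0.
have f10 : f1 != 0.
  by apply: contraTneq (eqxx (msize f1)) => f0; rewrite {2}deg_f1 f0 msize0.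
have d1 : (msize f1 <= 7)%N by rewrite deg_f1.
have d2 : (msize f2 <= 7)%N by rewrite deg_f2.
have d3 : (msize f3 <= 7)%N by rewrite deg_f3.
have [c c0 [E1 E2 E3]] := @system_unique K (cst_K eta) (cst_K b0) (cst_K b1) (cst_K b2)
  (cst_K b3) (two_neq0_K R) sumK e0 e1 eN1 b20 f1 f2 f3 f10 d1 d2 d3
  at0 ateta atd atd1 inf1 inf2 inf3.
have bE := time_scale e0 c0.
(* The factor in front of the equations is 2 eta/b, to be equal to - 2/c. *)
exists (- (cst_K eta * c)), b0, b3, b2, b1, b3; split.
- exact: time_scale_neq0 e0 c0.
- exact: etrans (parameter_sum _ _ _ _) sum_b.
- by [].
rewrite /D4_system tnth3_0 tnth3_1 tnth3_2.
have -> : 2 * cst_t eta / - (cst_K eta * c) = - 2 / c := bE.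
split; [exact: E1 | exact: E2 | exact: E3].
Qed.
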